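(* Consider the tangle with $N$ selfish nodes and $\kappa N$ nodes following the default attachment strategy, as described in the context, and suppose that Assumptions L and D (stated in the context) hold. For any $\varepsilon>0$ there exists $N_0$ (depending on the default attachment strategy) such that, for all $N\ge N_0$ and any Nash equilibrium $(\mathcal{S}_1,\ldots,\mathcal{S}_N)\in\mathcal{Q}^N$, it holds that $$\big|\mathfrak{C}^{(k)}(\mathcal{S}_1,\ldots,\mathcal{S}_N)-\mathfrak{C}^{(j)}(\mathcal{S}_1,\ldots,\mathcal{S}_N)\big|<\varepsilon$$ for all $k,j\in\{1,\ldots,N\}$.
   Context: **Tangle.** The tangle is a growing directed acyclic multigraph. It starts from a single vertex (the genesis), and vertices (called transactions) arrive one at a time and are never deleted. Each arriving transaction $v$ chooses two (not necessarily distinct) already present vertices $v',v''$, and the edges $(v,v'),(v,v'')$ are added (''$v$ is attached to, or approves, $v'$ and $v''$''). A vertex $u$ references a vertex $v$ if there is a directed path (of length at least 1) from $u$ to $v$. A tip is a vertex with no incoming edges. $\mathcal{T}(t)$ denotes the tangle at time $t$. Vertices carry no data and there are no reattachments of transactions. **Nodes.** Fix $\kappa>0$. There are $\kappa N$ nodes following a fixed default attachment strategy and $N$ selfish nodes. All $(\kappa+1)N$ nodes issue transactions independently at the same Poisson rate $\lambda/((\kappa+1)N)$, where $\lambda>0$. So, in discrete time (counted by arrivals), each new transaction is issued by a uniformly chosen node, independently of everything else; it is issued by a default node with probability $\kappa/(\kappa+1)$ and by a given selfish node with probability $1/((\kappa+1)N)$. **Strategies.** Fix integers $0<n_0<n_1$.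 To model network delays, an incoming transaction has no information about the last $n_0$ transactions attached to the tangle. Let $\mathcal{G}_{n_1}$ be the (finite) set of all possible sub-DAGs with $n_1$ vertices, representing restrictions of the tangle to the last $n_1$ transactions. An attachment method is a map that assigns to each element of $\mathcal{G}_{n_1}$ a probability measure on ordered pairs of its vertices (the law of the pair of attachment locations). The available simple strategies form a family $\{\mathcal{J}_\beta,\ \beta\in\mathfrak{A}\}$ of attachment methods, where $\mathfrak{A}$ is some index set; viewed as a subset of $\mathbb{R}^d$ for a suitable $d=d(n_1)$, this family is assumed to be compact. $\mathcal{Q}$ is the set of mixed strategies $\mathcal{J}_\Xi$, with $\Xi$ a random variable on $\mathfrak{A}$; it is the convex hull of the set of simple strategies. Each selfish node $k$ uses a strategy $\mathcal{S}_k\in\mathcal{Q}$ for each transaction it issues. **Default strategy.** The default attachment strategy selects the two vertices to approve by running two independent copies of a fixed tip-selecting random walk on the (restricted, visible) tangle, each stopped upon hitting the set of tips. The walk at a vertex $x$ moves with total probability $q\in[0,1/2)$ to a uniformly chosen vertex approved by $x$ (no such backtracking at the starting vertex), and with total probability $1-q$ to a vertex $y$ approving $x$, chosen with probability proportional to $f(H_x-H_y)$. Here $f:\mathbb{R}_+\to\mathbb{R}_+$ is a fixed non-increasing function and $H_x$ is $1$ plus the number of vertices that reference $x$. By Assumption L its law depends only on the restriction of the tangle to the last $n_1$ transactions. **Assumption L.** The attachment strategies of all nodes (including those using the default strategy) depend only on the restriction of the tangle to the last $n_1$ transactions that they see. **Assumption D.** When all nodes use the default attachment strategy, the restriction of the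 tangle to the last $n_1$ transactions, which is a Markov chain on $\mathcal{G}_{n_1}$, is irreducible and aperiodic. **Cost.** Fix $M_0\in\mathbb{N}$. For a transaction $v$, let $t^{(v)}_1,\ldots,t^{(v)}_{M_0}$ be the times at which the $M_0$ transactions following $v$ are attached. Let $R^{(v)}_k$ be the event that the default tip-selecting walk on $\mathcal{T}(t^{(v)}_k)$ stops in a tip that does not reference $v$, and let $W(v)=\mathbf{1}_{R^{(v)}_1}+\cdots+\mathbf{1}_{R^{(v)}_{M_0}}$. If $(v^{(k)}_j,\ j\ge 1)$ are the transactions issued by the $k$th selfish node, its mean cost when the selfish nodes use strategies $\mathcal{S}_1,\ldots,\mathcal{S}_N$ is $$\mathfrak{C}^{(k)}(\mathcal{S}_1,\ldots,\mathcal{S}_N)=M_0^{-1}\lim_{n\to\infty}\frac{W(v^{(k)}_1)+\cdots+W(v^{(k)}_n)}{n}.$$ **Nash equilibrium.** $(\mathcal{S}_1,\ldots,\mathcal{S}_N)\in\mathcal{Q}^N$ is a Nash equilibrium if $\mathfrak{C}^{(k)}(\mathcal{S}_1,\ldots,\mathcal{S}_k,\ldots,\mathcal{S}_N)\le\mathfrak{C}^{(k)}(\mathcal{S}_1,\ldots,\mathcal{S}_{k-1},\mathcal{S}',\mathcal{S}_{k+1},\ldots,\mathcal{S}_N)$ for any $k$ and any $\mathcal{S}'\in\mathcal{Q}$. The quantities $\kappa,n_0,n_1,M_0$, the set $\mathcal{Q}$ and the default strategy are fixed and do not depend on $N$. *)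

(* Defs.v *)
From HB Require Import structures.
From mathcomp Require Import all_boot all_order all_algebra.
From mathcomp Require Import all_classical all_reals all_analysis.
Set Implicit Arguments.
Unset Strict Implicit.
Unset Printing Implicit Defensive.
Import Order.TTheory GRing.Theory Num.Theory.
Import numFieldNormedType.Exports.
Local Open Scope ring_scope.

Definition references (T : eqType) (e : rel T) (u v : T) : Prop :=
  exists s : seq T, path e u (rcons s v).

(* Vertices are numbered by age, 0 being the oldest; [g (u, v)] is the number
   of edges from [u] to [v].  A vertex has fewer than two outgoing edges when
   some of its edges lead out of the sub-DAG. *)
Definition is_subdag m (g : {ffun 'I_m * 'I_m -> 'I_3}) : bool :=
  [forall u : 'I_m, forall v : 'I_m, (0 < g (u, v))%N ==> (v < u)%N] &&
  [forall u : 'I_m, (\sum_(v < m) g (u, v) <= 2)%N].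

Record dag m := Dag
  { mult : {ffun 'I_m * 'I_m -> 'I_3}; mult_subdag : is_subdag mult }.
HB.instance Definition _ m := [isSub for @mult m].
HB.instance Definition _ m := [Finite of dag m by <:].

Lemma is_subdag_arcs m (e : nat -> nat -> nat) :
  (forall i j, (i < m)%N -> (j < m)%N -> (0 < e i j)%N -> (j < i)%N) ->
  (forall i, (i < m)%N -> (\sum_(j < m) e i j <= 2)%N) ->
  is_subdag [ffun uv : 'I_m * 'I_m => (inord (e uv.1 uv.2) : 'I_3)].
Proof.
move=> e_lt e_sum.
have e_inord (u v : 'I_m) : (inord (e u v) : 'I_3) = e u v :> nat.
  rewrite inordK // ltnS; apply: leq_trans (e_sum u (ltn_ord u)).
  by rewrite (bigD1 v) //= leq_addr.
apply/andP; split.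
  apply/forallP => u; apply/forallP => v; apply/implyP.
  by rewrite ffunE /= e_inord; apply: e_lt.
apply/forallP => u; rewrite (eq_bigr (fun v : 'I_m => e u v)) ?e_sum // => v _.
by rewrite ffunE /= e_inord.
Qed.

Definition arcs m (g : dag m) (i j : nat) : nat :=
  if (insub i, insub j) is (Some u, Some v) then mult g (u, v) else 0%N.

Lemma arcs_lt m (g : dag m) i j : (0 < arcs g i j)%N -> (j < i)%N.
Proof.
rewrite /arcs; case: insubP => // u _ <-; case: insubP => // v _ <- uv.
by have /andP[/forallP/(_ u)/forallP/(_ v)/implyP/(_ uv)] := mult_subdag g.
Qed.

Lemma arcs_big m (g : dag m) i j : (m <= j)%N -> arcs g i j = 0%N.
Proof. by move=> mj; rewrite /arcs; case: insubP => // u _ _; rewrite insubN // -leqNgt. Qed.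

Lemma arcs_sum m (g : dag m) i n : (\sum_(j < n) arcs g i j <= 2)%N.
Proof.
have le_m : (\sum_(j < m) arcs g i j <= 2)%N.
  rewrite /arcs; case: insubP => [u _ _|_]; last by rewrite big1.
  have /andP[_ /forallP/(_ u)] := mult_subdag g; apply: leq_trans.
  by apply: leq_sum => v _; rewrite valK.
apply: leq_trans le_m; rewrite -(big_mkord xpredT (arcs g i)).
rewrite -(big_mkord xpredT (arcs g i)).
have [nm|/ltnW mn] := leqP n m.
  by rewrite [leqRHS](big_cat_nat _ nm) //= leq_addr.
rewrite (big_cat_nat _ mn) //= [X in (_ + X)%N]big_nat_cond [X in (_ + X)%N]big1 ?addn0 //.
by move=> j /andP[/andP[mj _] _]; rewrite arcs_big.
Qed.

Lemma sum_eq_shift_le1 n (a k : nat) : (\sum_(j < n) (a == k + j)%N <= 1)%N.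
Proof.
have [[j aj]|no] := pselect (exists j : 'I_n, a == (k + j)%N).
  rewrite (bigD1 j) //= aj big1 // => i ij; apply/eqP; rewrite eqb0.
  apply: contra ij => /eqP ai; move: aj; rewrite ai eqn_add2l => /eqP ij.
  by apply/eqP/val_inj.
by rewrite big1 // => j _; apply/eqP; rewrite eqb0; apply/negP => aj; apply: no; exists j.
Qed.

Fact oldest_subdag m k (g : dag m) :
  is_subdag [ffun uv : 'I_k * 'I_k => (inord (arcs g uv.1 uv.2) : 'I_3)].
Proof.
by apply: is_subdag_arcs => [i j _ _ /arcs_lt|i _] //; exact: arcs_sum.
Qed.

(* The restriction to the [k] oldest vertices (used for [k <= m]). *)
Definition oldest m k (g : dag m) : dag k := Dag (oldest_subdag k g).

(* The arrival of a transaction attached to [p.1] and [p.2]: the oldest vertex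
   leaves the window and the new one becomes the vertex [m.-1]. *)
Definition next_arcs m (g : dag m) (p : 'I_m * 'I_m) (i j : nat) : nat :=
  if i.+1 == m then ((p.1 == j.+1 :> nat) + (p.2 == j.+1 :> nat))%N
  else arcs g i.+1 j.+1.

Fact next_subdag m (g : dag m) (p : 'I_m * 'I_m) :
  is_subdag [ffun uv : 'I_m * 'I_m => (inord (next_arcs g p uv.1 uv.2) : 'I_3)].
Proof.
apply: (@is_subdag_arcs m (next_arcs g p)) => [i j _ _|i _];
  rewrite /next_arcs; have [im|_] := eqVneq i.+1 m.
- rewrite addn_gt0 !lt0b -ltnS im.
  by case/orP => /eqP e; move: (ltn_ord p.1) (ltn_ord p.2); rewrite e.
- by move=> /arcs_lt; rewrite ltnS.
- rewrite big_split /=.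
  exact: (leq_add (sum_eq_shift_le1 _ _ 1) (sum_eq_shift_le1 _ _ 1)).
- have := arcs_sum g i.+1 m.+1; rewrite big_ord_recl; apply: leq_trans.
  by rewrite leq_addl.
Qed.

Definition next_window m (g : dag m) (p : 'I_m * 'I_m) : dag m := Dag (next_subdag g p).

(* [att n] is the pair of transactions to which transaction [n > 0] attaches;
   transaction 0 is the genesis and [att 0] is irrelevant. *)
Definition attaches (att : nat -> nat * nat) : rel nat :=
  fun u v => (0 < u)%N && (((att u).1 == v) || ((att u).2 == v)).

Definition window_arcs (att : nat -> nat * nat) (off i j : nat) : nat :=
  if (j < i)%N then
    (((att (off + i)%N).1 == (off + j)%N) + ((att (off + i)%N).2 == (off + j)%N))%N
  else 0%N.

Fact window_subdag m (att : nat -> nat * nat) off :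
  is_subdag [ffun uv : 'I_m * 'I_m => (inord (window_arcs att off uv.1 uv.2) : 'I_3)].
Proof.
apply: (@is_subdag_arcs m (window_arcs att off)) => [i j _ _|i _];
  rewrite /window_arcs; first by case: ifP.
pose h j := (((att (off + i)%N).1 == (off + j)%N) + ((att (off + i)%N).2 == (off + j)%N))%N.
apply: (@leq_trans (\sum_(j < m) h j)); first by apply: leq_sum => j _; case: ifP.
rewrite big_split /=.
exact: (leq_add (sum_eq_shift_le1 _ _ off) (sum_eq_shift_le1 _ _ off)).
Qed.

(* The restriction of the tangle to the transactions off, ..., off + m - 1. *)
Definition window m (att : nat -> nat * nat) (off : nat) : dag m :=
  Dag (window_subdag m att off).

Section TipWalk.
Context {R : realType}.

Record walk_rule := WalkRule {
  backtrack : R;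
  bias : R -> R;
  (* law of the starting vertex, as a function of the DAG walked upon *)
  start : forall m, dag m -> 'I_m -> R }.

(* On sub-DAGs with at most [n1] vertices, H_x - H_y is an integer smaller than
   [n1]; the last condition on [bias] says that the weights of the vertices
   approving a given vertex do not all vanish. *)
Definition valid_walk_rule (n1 : nat) (w : walk_rule) : Prop :=
  [/\ 0 <= backtrack w < 2^-1,
      forall x, 0 <= x -> 0 <= bias w x,
      forall x y, 0 <= x -> x <= y -> bias w y <= bias w x,
      forall k, (k < n1)%N -> 0 < bias w k%:R &
      forall m (g : dag m), (0 < m)%N ->
        (forall s, 0 <= start w g s) /\ \sum_s start w g s = 1].

Section OnDag.
Variables (w : walk_rule) (m : nat) (g : dag m).

Definition approves : rel 'I_m := fun u v => (0 < mult g (u, v))%N.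

Definition tip (x : 'I_m) : bool := [forall y, ~~ approves y x].

Definition weight (x : 'I_m) : nat :=
  #|[pred u | `[< references approves u x >]]|.+1.

Definition forward (x y : 'I_m) : R :=
  let b z := bias w ((weight x)%:R - (weight z)%:R) in
  if approves y x then b y / \sum_(z | approves z x) b z else 0.

Definition backward (x y : 'I_m) : R :=
  if approves x y then #|[pred z | approves x z]|%:R^-1 else 0.

(* The walk started at [s] and frozen at the tips; it does not backtrack from
   vertices which approve nothing within the sub-DAG. *)
Definition walk_step (s x y : 'I_m) : R :=
  if tip x then (y == x)%:R
  else let q := if (x != s) && [exists z, approves x z] then backtrack w else 0 in
       q * backward x y + (1 - q) * forward x y.

Fixpoint walk_law (s : 'I_m) (n : nat) (y : 'I_m) : R :=
  if n is n'.+1 then \sum_x walk_law s n' x * walk_step s x y else (y == s)%:R.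

(* At a tip, [walk_law s n z] is the probability that the walk has stopped at [z]
   by time [n]. *)
Definition exit_law (z : 'I_m) : R :=
  if tip z then \sum_s start w g s * limn (fun n => walk_law s n z) else 0.

End OnDag.
End TipWalk.
Arguments walk_rule R : clear implicits.

Definition method (R : realType) (n1 : nat) := dag n1 -> 'I_n1 * 'I_n1 -> R.

Section Methods.
Context {R : realType} (n0 n1 : nat).
Implicit Types J S : method R n1.

Definition attachment_method J : Prop :=
  forall g, (forall p, 0 <= J g p) /\ \sum_p J g p = 1.

(* The last [n0] transactions are unknown to the incoming one. *)
Definition delayed J : Prop :=
  (forall g g', oldest (n1 - n0) g = oldest (n1 - n0) g' -> J g =1 J g') /\
  (forall g p, J g p != 0 -> (p.1 < n1 - n0)%N && (p.2 < n1 - n0)%N).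

Definition vectorize J : 'rV[R]_#|{: dag n1 * ('I_n1 * 'I_n1)}| :=
  \row_i J (enum_val i).1 (enum_val i).2.

Definition default_method (w : walk_rule R) : method R n1 := fun g p =>
  let ex (i : 'I_n1) :=
    \sum_(z : 'I_(n1 - n0) | z == i :> nat) exit_law w (oldest (n1 - n0) g) z in
  ex p.1 * ex p.2.

Definition simple_strategies (A : Type) (J : A -> method R n1) : Prop :=
  (forall b, attachment_method (J b) /\ delayed (J b)) /\
  compact [set vectorize (J b) | b in @setT A].

(* [S] is J_Xi for some random variable Xi on the index set.  The measurability
   required of Xi is that of its image in the space of attachment methods. *)
Definition is_mixed (A : Type) (J : A -> method R n1) S : Prop :=
  exists (d : measure_display) (Om : measurableType d) (P : probability Om R)
         (Xi : Om -> A),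
    forall g p, measurable_fun setT (fun om => J (Xi om) g p) /\
      ((S g p)%:E = \int[P]_om (J (Xi om) g p)%:E)%E.

Definition mixed_strategy (A : Type) (J : A -> method R n1) := {S | is_mixed J S}.

Definition window_kernel J (g g' : dag n1) : R := \sum_(p | next_window g p == g') J g p.

(* The windows that occur with positive probability when the nodes use [D] and
   the methods [J b], from the window [g0] onwards. *)
Inductive possible (A : Type) (D : method R n1) (J : A -> method R n1)
    (g0 : dag n1) : dag n1 -> Prop :=
| possible0 : possible D J g0 g0
| possible_default g p : possible D J g0 g -> 0 < D g p -> possible D J g0 (next_window g p)
| possible_simple g p b :
    possible D J g0 g -> 0 < J b g p -> possible D J g0 (next_window g p).

End Methods.

Fixpoint nstep (R : realType) (T : finType) (K : T -> T -> R) (n : nat) (x y : T) : R :=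
  if n is n'.+1 then \sum_z nstep K n' x z * K z y else (y == x)%:R.

Definition irreducible_on (R : realType) (T : finType) (G : T -> Prop)
    (K : T -> T -> R) : Prop :=
  forall x y, G x -> G y -> exists n, 0 < nstep K n x y.

Definition aperiodic_on (R : realType) (T : finType) (G : T -> Prop)
    (K : T -> T -> R) : Prop :=
  forall x, G x -> forall d : nat,
    (forall n, (0 < n)%N -> 0 < nstep K n x x -> (d %| n)%N) -> d = 1%N.

(* Before the nodes start to use their strategies, which need [n1] transactions,
   there are [L + n1] transactions, attached in the way described by [init]. *)
Definition valid_init (L n1 : nat) (init : nat -> nat * nat) : Prop :=
  forall n, (0 < n < L + n1)%N -> ((init n).1 < n)%N && ((init n).2 < n)%N.

(* What happens at the arrival of a transaction: its issuer ([Some k] for the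
   selfish node [k], [None] for a default node), the positions in the current
   window of the transactions it attaches to and, just after its attachment, the
   positions in the new window where [M0] runs of the default walk stop. *)
Definition event (N n1 M0 : nat) : finType :=
  (option 'I_N * ('I_n1 * 'I_n1) * {ffun 'I_M0 -> 'I_n1})%type.

Section Process.
Context {R : realType}.
Variables (kappa : R) (n0 n1 M0 : nat) (w : walk_rule R).
Variables (L : nat) (init : nat -> nat * nat).

Section Trajectory.
Variables (N : nat) (e : nat -> event N n1 M0).

Definition issuer i := (e i).1.1.
Definition sites i := (e i).1.2.
Definition stops i := (e i).2.

(* [e i] describes the arrival of the transaction [L + n1 + i], when the last
   [n1] transactions are L + i, ..., L + i + n1 - 1. *)
Definition tangle (n : nat) : nat * nat :=
  if (n < L + n1)%N then init n
  else let i := (n - (L + n1))%N in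
       ((L + i + (sites i).1)%N, (L + i + (sites i).2)%N).

Definition window_before i : dag n1 := window n1 tangle (L + i).
Definition window_after i : dag n1 := window n1 tangle (L + i.+1).

(* The number W(v) for the transaction v = L + n1 + i. *)
Definition badness (i : nat) : nat :=
  \sum_(k < M0)
    `[< ~ references (attaches tangle)
            (L + (i + k.+1).+1 + stops (i + k.+1) k)%N (L + n1 + i)%N >].

(* [l] is the limit of the averages of W over the transactions of node [k]. *)
Definition mean_badness (k : 'I_N) (l : R) : Prop :=
  exists v : nat -> nat,
    [/\ {homo v : i j / (i < j)%N},
        forall i, issuer i = Some k <-> exists j, v j = i &
        ((fun n => (\sum_(j < n) badness (v j))%:R / n%:R : R) @ \oo --> l)%classic].

End Trajectory.

Section Law.
Variables (N : nat) (S : 'I_N -> method R n1).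

Definition issuer_prob (o : option 'I_N) : R :=
  if o is Some _ then ((kappa + 1) * N%:R)^-1 else kappa / (kappa + 1).

Definition method_of (o : option 'I_N) : method R n1 :=
  if o is Some k then S k else default_method n0 w.

(* Conditional probability of [e i] given [e 0], ..., [e i.-1]. *)
Definition event_prob (e : nat -> event N n1 M0) (i : nat) : R :=
  issuer_prob (issuer e i) *
  method_of (issuer e i) (window_before e i) (sites e i) *
  \prod_(k < M0) exit_law w (window_after e i) (stops e i k).

Record tangle_process := TangleProcess {
  disp : measure_display;
  space : measurableType disp;
  prob : probability space R;
  events : nat -> space -> event N n1 M0;
  events_measurable : forall i a, measurable [set om | events i om = a]%classic;
  events_law : forall n (e : nat -> event N n1 M0),
    prob [set om | forall i, (i < n)%N -> events i om = e i]%classic =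
    (\prod_(i < n) event_prob e i)%:E }.

Definition mean_cost (T : tangle_process) (k : 'I_N) : R :=
  M0%:R^-1 * xget 0 [set l : R |
    {ae prob T, forall om, mean_badness (fun i => @events T i om) k l}]%classic.

End Law.

Definition Tangle N A (J : A -> method R n1) (S : 'I_N -> mixed_strategy J) :=
  tangle_process (fun k => sval (S k)).

Section Nash.
Variables (N : nat) (A : Type) (J : A -> method R n1).
Variable (T : forall S : 'I_N -> mixed_strategy J, Tangle S).

Definition deviate (S : 'I_N -> mixed_strategy J) (k : 'I_N) (S' : mixed_strategy J) :=
  fun i => if i == k then S' else S i.

Definition nash_equilibrium (S : 'I_N -> mixed_strategy J) : Prop :=
  forall k S', mean_cost (T S) k <= mean_cost (T (deviate S k S')) k.

End Nash.
End Process.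

(* Main.v *)
(** Write [K] for the transition kernel of the window of the last [n1]
    transactions.  Default nodes issue a fixed share kappa / (kappa + 1) of the
    transactions, so [K] dominates that multiple of the default kernel, which is
    irreducible on the set of possible windows.  Hence the Poisson equation
    [f - m = u - K u] is solvable there with [u] bounded by a multiple of [f]
    that depends on the default strategy only.  The solution turns time averages
    of [f] into sums of variables uncorrelated beyond lag [M0], which gives a law
    of large numbers (second moments, then Borel-Cantelli along fourth powers):
    the mean cost of a node is the constant [m] for the cost [f] of the
    transactions it issues.  When one node changes its strategy, [K] moves by
    O(1/N), and comparing the two Poisson equations by the maximum principle
    shows that the mean costs of the other nodes move by O(1/N).  Finally, in
    an equilibrium node [k] does not gain by copying node [j]; after copying,
    both have the same cost, which is within O(1/N) of the cost of [j] before. *)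

Require Import Defs.
From mathcomp Require Import all_boot all_order all_algebra.
From mathcomp Require Import all_classical all_reals all_analysis.
From mathcomp Require Import measurable_realfun.
From mathcomp Require Import ring lra zify.
Set Implicit Arguments.
Unset Strict Implicit.
Unset Printing Implicit Defensive.
Import Order.TTheory GRing.Theory Num.Theory.
Import numFieldNormedType.Exports.
Local Open Scope ring_scope.

(** * The tip-selecting walk stops *)

Section TipWalkLaw.
Context {R : realType} (n1 : nat) (w : walk_rule R) (w_valid : valid_walk_rule n1 w).
Context (m : nat) (g : dag m) (m_gt0 : (0 < m)%N) (m_le : (m <= n1)%N).

Lemma approves_lt (u v : 'I_m) : approves g u v -> (v < u)%N.
Proof.
have /andP[/forallP/(_ u)/forallP/(_ v)/implyP uv _] := mult_subdag g.
exact: uv.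
Qed.

Lemma references_lt (u v : 'I_m) : references (approves g) u v -> (v < u)%N.
Proof.
case=> s; elim: s u => [|x s IHs] u /= /andP[]; first by move/approves_lt.
by move=> /approves_lt xu /IHs vx; apply: ltn_trans xu.
Qed.

(** Whatever references [y] also references [x] through the edge from [y] to [x]; moreover [y]
    references [x] but not itself. *)
Lemma weight_ltn (x y : 'I_m) : approves g y x -> (weight g y < weight g x)%N.
Proof.
move=> yx; rewrite /weight ltnS; apply/proper_card/properP; split.
  apply/fintype.subsetP => z; rewrite !inE => -[s zy].
  by exists (rcons s y); rewrite rcons_path zy last_rcons yx.
exists y; first by rewrite inE; exists [::]; rewrite /= yx.
by apply/negP; rewrite inE => /references_lt; rewrite ltnn.
Qed.

Lemma weight_leq (x : 'I_m) : (weight g x <= m)%N.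
Proof.
rewrite -{2}(card_ord m) /weight; apply/proper_card/properP; split.
  exact/fintype.subsetP.
by exists x; last by apply/negP; rewrite inE => /references_lt; rewrite ltnn.
Qed.

(** Weights lie between 1 and [m], so their difference is a natural number below [n1], where the
    bias is assumed positive. *)
Lemma bias_gt0 (x y : 'I_m) : approves g y x ->
  0 < bias w ((weight g x)%:R - (weight g y)%:R).
Proof.
case: w_valid => _ _ _ w_gt0 _ yx; have lt_yx := weight_ltn yx.
rewrite -(natrB _ (ltnW lt_yx)); apply: w_gt0; apply: leq_trans m_le.
by apply: leq_trans (weight_leq x); rewrite ltn_subrL (leq_ltn_trans _ lt_yx).
Qed.

Lemma forward_ge0 x y : 0 <= forward w g x y.
Proof.
rewrite /forward; case: ifP => // yx.
by rewrite divr_ge0 ?(ltW (bias_gt0 _)) ?sumr_ge0 // => z /bias_gt0/ltW.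
Qed.

Lemma sum_forward x : ~~ tip g x -> \sum_y forward w g x y = 1.
Proof.
move=> /forallPn[y0 /negPn y0x]; rewrite /forward -big_mkcond /= -mulr_suml divff //.
rewrite gt_eqF // (bigD1 y0) //= ltr_pwDl ?bias_gt0 //.
by apply: sumr_ge0 => z /andP[/bias_gt0/ltW].
Qed.

Lemma backward_ge0 x y : 0 <= backward (R := R) g x y.
Proof. by rewrite /backward; case: ifP => // _; rewrite invr_ge0. Qed.

Lemma sum_backward x : [exists z, approves g x z] ->
  \sum_y backward (R := R) g x y = 1.
Proof.
move=> /existsP[z0 xz0]; rewrite /backward -big_mkcond /= sumr_const.
rewrite -[RHS](@mulVf _ #|[pred z | approves g x z]|%:R) ?mulr_natr //.
by rewrite pnatr_eq0 -lt0n; apply/card_gt0P; exists z0.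
Qed.

Lemma walk_step_ge0 s x y : 0 <= walk_step w g s x y.
Proof.
case: w_valid => /andP[q_ge0 q_lt] _ _ _ _; rewrite /walk_step; case: ifP => // _.
by rewrite addr_ge0 // mulr_ge0 ?forward_ge0 ?backward_ge0 //; case: ifP => // _; lra.
Qed.

Lemma sum_walk_step s x : \sum_y walk_step w g s x y = 1.
Proof.
rewrite /walk_step; have [_|ntip] := boolP (tip g x).
  by rewrite (bigD1 x) //= eqxx big1 ?addr0 // => y /negPf->.
rewrite big_split /= -!mulr_sumr sum_forward //.
case: ifP => [/andP[_ /sum_backward->]|_]; first by ring.
by ring.
Qed.

Lemma walk_law_ge0 s n y : 0 <= walk_law w g s n y.
Proof.
elim: n y => [|n IHn] y /=; first by rewrite ler0n.
by apply: sumr_ge0 => x _; rewrite mulr_ge0 ?walk_step_ge0.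
Qed.

Lemma sum_walk_law s n : \sum_y walk_law w g s n y = 1.
Proof.
elim: n => [|n IHn] /=.
  by rewrite (bigD1 s) //= eqxx big1 ?addr0 // => y /negPf->.
rewrite exchange_big -[RHS]IHn; apply: eq_bigr => x _ /=.
by rewrite -mulr_sumr sum_walk_step mulr1.
Qed.

Lemma walk_law_le1 s n y : walk_law w g s n y <= 1.
Proof.
rewrite -(sum_walk_law s n) (bigD1 y) //= lerDl sumr_ge0 // => x _.
exact: walk_law_ge0.
Qed.

(** The walk is frozen at tips, so the mass collected there never leaves. *)
Lemma walk_law_tip_nd s z : tip g z ->
  {homo (fun n => walk_law w g s n z) : n k / (n <= k)%N >-> n <= k}.
Proof.
move=> tz; apply: homo_leq => [//|? ? ?|n /=]; first exact: le_trans.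
rewrite (bigD1 z) //= /walk_step tz eqxx mulr1 lerDl sumr_ge0 // => x _.
by rewrite -/(walk_step w g s x z) mulr_ge0 ?walk_law_ge0 ?walk_step_ge0.
Qed.

(* A non-tip moves forward with probability at least 1/2, so the mean of
   4 ^ (position) grows by at least 1 per step taken away from the tips. *)
Lemma walk_step_potential (s x : 'I_m) :
  4 ^+ x + (~~ tip g x)%:R <= \sum_y walk_step w g s x y * 4 ^+ y.
Proof.
case: w_valid => /andP[q_ge0 q_lt] _ _ _ _.
rewrite /walk_step; have [tx|ntip] := boolP (tip g x).
  by rewrite (bigD1 x) //= eqxx mul1r big1 ?addr0 // => y /negPf->; rewrite mul0r.
set q := if _ then _ else _.
have q01 : 0 <= q < 2^-1 by rewrite /q; case: ifP; lra.
have q1 : 0 <= 1 - q by lra.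
(* Only forward moves are kept. They lead to later positions, where the potential is at least
   [4 * 4 ^+ x]; as [1 - q] exceeds 1/2, this gives at least [2 * 4 ^+ x], hence at least
   [4 ^+ x + 1]. *)
apply: (@le_trans _ _ (\sum_y (1 - q) * (forward w g x y * (4 * 4 ^+ x)))).
  rewrite -mulr_sumr -mulr_suml sum_forward //.
  have : 1 <= 4 ^+ x :> R by rewrite exprn_ege1 // ler1n.
  move: (4 ^+ x : R) => t t1 /=; rewrite mul1r; clearbody q.
  by case/andP: q01 => q0 qlt; nra.
apply: ler_sum => y _; rewrite [leRHS]mulrDl.
apply: (@le_trans _ _ ((1 - q) * forward w g x y * 4 ^+ y)); last first.
  by case/andP: q01 => q0 _; rewrite lerDr mulr_ge0 ?exprn_ge0 ?mulr_ge0 ?backward_ge0.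
rewrite -mulrA ler_wpM2l //.
have [yx|nyx] := boolP (approves g y x); last first.
  by rewrite /forward (negPf nyx) !mul0r.
by rewrite ler_wpM2l ?forward_ge0 // -exprS ler_weXn2l ?ler1n // approves_lt.
Qed.

(** Summed over time, the potential inequality bounds the mean number of visits to non-tips by the
    mean potential at time [n]. *)
Lemma sum_nontip_le s n :
  \sum_(i < n) \sum_(x | ~~ tip g x) walk_law w g s i x <= 4 ^+ m.
Proof.
apply: (@le_trans _ _ (\sum_y walk_law w g s n y * 4 ^+ y)); last first.
  apply: (@le_trans _ _ (\sum_y walk_law w g s n y * 4 ^+ m)).
    apply: ler_sum => y _; rewrite ler_wpM2l ?walk_law_ge0 //.
    by rewrite ler_weXn2l ?ler1n // ltnW.
  by rewrite -mulr_suml sum_walk_law mul1r.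
elim: n => [|n IHn].
  by rewrite big_ord0 sumr_ge0 // => y _; rewrite mulr_ge0 ?walk_law_ge0 ?exprn_ge0.
rewrite big_ord_recr /=; apply: le_trans (lerD IHn (lexx _)) _.
under [leRHS]eq_bigr do rewrite mulr_suml.
rewrite exchange_big [X in _ + X]big_mkcond -big_split; apply: ler_sum => x _ /=.
under [leRHS]eq_bigr do rewrite -mulrA.
rewrite -mulr_sumr; apply: le_trans (ler_wpM2l (walk_law_ge0 s n x) (walk_step_potential s x)).
by rewrite mulrDr; case: ifP => _; rewrite ?mulr1 ?mulr0.
Qed.

Lemma walk_law_tip_cvg s z : tip g z -> cvgn (fun n => walk_law w g s n z).
Proof.
move=> tz; apply: nondecreasing_is_cvgn; first exact: walk_law_tip_nd.
by exists 1 => _ [n _ <-]; exact: walk_law_le1.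
Qed.

(** The mass on non-tips is summable over time, hence tends to 0, so none is lost when the
    increasing masses of the tips pass to the limit. *)
Lemma sum_lim_walk_law s :
  \sum_(z | tip g z) limn (fun n => walk_law w g s n z) = 1.
Proof.
have lim_tip : ((fun n => \sum_(z | tip g z) walk_law w g s n z) @ \oo -->
    \sum_(z | tip g z) limn (fun n => walk_law w g s n z))%classic.
  apply: cvg_big => [|z tz]; [exact: add_continuous|exact: walk_law_tip_cvg].
have split_tip n : \sum_(x | ~~ tip g x) walk_law w g s n x =
    1 - \sum_(z | tip g z) walk_law w g s n z.
  by rewrite -(sum_walk_law s n) (bigID (tip g) predT) /= addrC addrK.
have nontip0 :
    ((fun n => \sum_(x | ~~ tip g x) walk_law w g s n x) @ \oo --> (0 : R))%classic.
  apply: cvg_series_cvg_0; apply: nondecreasing_is_cvgn.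
    apply: nondecreasing_series => n _ _; apply: sumr_ge0 => x _.
    exact: walk_law_ge0.
  exists (4 ^+ m) => _ [n _ <-]; rewrite /series /= big_mkord; exact: sum_nontip_le.
have : ((fun n => 1 - \sum_(x | ~~ tip g x) walk_law w g s n x) @ \oo -->
    (1 - 0 : R))%classic.
  by apply: cvgB => //; exact: cvg_cst.
under eq_fun do rewrite split_tip subKr.
by rewrite subr0 => lim1; rewrite -(cvg_lim _ lim_tip) // (cvg_lim _ lim1).
Qed.

Lemma exit_law_ge0 z : 0 <= exit_law w g z.
Proof.
case: w_valid => _ _ _ _ /(_ m g m_gt0) [start_ge0 _].
rewrite /exit_law; case: ifP => // tz; apply: sumr_ge0 => s _.
rewrite mulr_ge0 // limr_ge //; first exact: walk_law_tip_cvg.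
by apply: nearW => n; exact: walk_law_ge0.
Qed.

Lemma sum_exit_law : \sum_z exit_law w g z = 1.
Proof.
case: w_valid => _ _ _ _ /(_ m g m_gt0) [_ start_sum].
rewrite /exit_law -big_mkcond exchange_big /= -[RHS]start_sum.
by apply: eq_bigr => s _; rewrite -mulr_sumr sum_lim_walk_law mulr1.
Qed.

End TipWalkLaw.

(** * Attachment methods *)

(** The law is a product, and each factor is the exit law on the visible part, embedded in the
    window by [widen_ord]. *)
Lemma default_attachment (R : realType) (n0 n1 : nat) (w : walk_rule R) :
  valid_walk_rule n1 w -> (n0 < n1)%N -> attachment_method (default_method (n1 := n1) n0 w).
Proof.
move=> w_valid n01 g; have m_gt0 : (0 < n1 - n0)%N by rewrite subn_gt0.
have m_le := leq_subr n0 n1; pose g' := oldest (n1 - n0) g.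
pose ex (i : 'I_n1) := \sum_(z : 'I_(n1 - n0) | z == i :> nat) exit_law w g' z.
have ex_ge0 i : 0 <= ex i by apply: sumr_ge0 => z _; exact: (exit_law_ge0 w_valid g' m_gt0 m_le).
split=> [p|]; first by rewrite /default_method mulr_ge0 // ex_ge0.
have sum_ex : \sum_i ex i = 1.
  rewrite /ex (exchange_big_dep predT) //= -[RHS](sum_exit_law w_valid g' m_gt0 m_le).
  by apply: eq_bigr => z _; rewrite (big_pred1 (widen_ord m_le z)).
rewrite /default_method -/g' -(pair_bigA _ (fun i j => ex i * ex j)) /=.
by under eq_bigr do rewrite -mulr_sumr sum_ex mulr1.
Qed.

Section Mixed.
Context {R : realType} {n1 : nat} {A : Type} {J : A -> method R n1} {S : method R n1}.
Hypotheses (J_att : forall b, attachment_method (J b)) (S_mixed : is_mixed J S).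

Lemma mixed_attachment : attachment_method S.
Proof.
case: S_mixed => d [Om [P [Xi SE]]] g; split=> [p|].
  rewrite -lee_fin (SE g p).2; apply: integral_ge0 => om _.
  by rewrite lee_fin (J_att _ _).1.
apply: EFin_inj; rewrite -sumEFin.
under eq_bigr do rewrite (SE g _).2.
rewrite -ge0_integral_sum //=; first last.
- by move=> p om _; rewrite lee_fin (J_att _ _).1.
- by move=> p; apply/measurable_EFinP; exact: (SE g p).1.
under eq_integral do rewrite sumEFin (J_att _ _).2.
by rewrite integral_cst //= mul1e probability_setT.
Qed.

(** A positive mean requires a positive value. This reduces moves of mixed strategies to those of
    simple ones, the selfish moves listed by [possible]. *)
Lemma mixed_gt0 g p : 0 < S g p -> exists b, 0 < J b g p.
Proof.
case: S_mixed => d [Om [P [Xi SE]]] Sgp; apply: contrapT => noJ.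
have J0 b : J b g p = 0.
  apply/eqP; rewrite eq_le (J_att b g).1 andbT leNgt; apply/negP => Jb.
  by apply: noJ; exists b.
move: Sgp; rewrite -lte_fin (SE g p).2.
under eq_integral do rewrite J0.
by rewrite integral0 ltxx.
Qed.

End Mixed.

(** * Poisson's equation for a finite kernel *)

Section Poisson.
Context {R : realType} {T : finType}.
Implicit Types (K H : T -> T -> R) (B : {set T}) (u v f d : T -> R) (m F : R).

Definition stochastic K := forall x, (forall y, 0 <= K x y) /\ \sum_y K x y = 1.

Definition closed_set K B := forall x y, x \in B -> K x y != 0 -> y \in B.

Definition kmean K u x := \sum_y K x y * u y.

(** When [B] is closed, [m] is the long-run mean of [f] along the chain started in [B]. Only [B]
    matters because irreducibility is assumed among possible windows only. *)
Definition poisson K B f m u := forall x, x \in B -> f x - m = u x - kmean K u x.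

Lemma le_kmean K B u v x : stochastic K -> closed_set K B -> x \in B ->
  (forall y, y \in B -> u y <= v y) -> kmean K u x <= kmean K v x.
Proof.
move=> Kst Kcl xB uv; apply: ler_sum => y _; have [K_ge0 _] := Kst x.
have [->|/Kcl yB] := eqVneq (K x y) 0; first by rewrite !mul0r.
by rewrite ler_wpM2l // uv // yB.
Qed.

Lemma kmean_cst K a x : stochastic K -> kmean K (fun=> a) x = a.
Proof. by move=> Kst; rewrite /kmean -mulr_suml (Kst x).2 mul1r. Qed.

(** At a minimum of [v] over [B], averaging by [K] stays in [B] and cannot decrease [v]. *)
Lemma min_principle K B v a : stochastic K -> closed_set K B -> B != finset.set0 ->
  (forall x, x \in B -> a <= v x - kmean K v x) -> a <= 0.
Proof.
move=> Kst Kcl /finset.set0Pn[x0 x0B] av.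
have [x xB xmin] : exists2 x, x \in B & forall y, y \in B -> v x <= v y.
  by case: (@arg_minP _ _ _ x0 (mem B) v x0B) => x; exists x.
apply: le_trans (av x xB) _; rewrite subr_le0 -{1}(kmean_cst (v x) x Kst).
exact: (le_kmean Kst Kcl xB xmin).
Qed.

Lemma kmeanN K v x : kmean K (fun y => - v y) x = - kmean K v x.
Proof. by rewrite /kmean -sumrN; apply: eq_bigr => y _; rewrite mulrN. Qed.

Lemma kmeanB K u v x : kmean K (fun y => u y - v y) x = kmean K u x - kmean K v x.
Proof. by rewrite /kmean -sumrB; apply: eq_bigr => y _; rewrite mulrBr. Qed.

Lemma max_principle K B v a : stochastic K -> closed_set K B -> B != finset.set0 ->
  (forall x, x \in B -> v x - kmean K v x <= a) -> 0 <= a.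
Proof.
move=> Kst Kcl Bn0 va; rewrite -oppr_le0.
apply: (min_principle (v := fun x => - v x) Kst Kcl Bn0) => x xB.
by rewrite kmeanN; have := va x xB; lra.
Qed.

Lemma poisson_mean_le K B f m u F : stochastic K -> closed_set K B ->
  B != finset.set0 -> (forall x, x \in B -> `|f x| <= F) -> poisson K B f m u ->
  `|m| <= F.
Proof.
move=> Kst Kcl Bn0 fF fu.
have h1 : - F - m <= 0.
  apply: (min_principle (v := u) Kst Kcl Bn0) => x xB; rewrite -fu // lerD2r.
  by have := fF x xB; rewrite ler_norml => /andP[].
have h2 : 0 <= F - m.
  apply: (max_principle (v := u) Kst Kcl Bn0) => x xB; rewrite -fu // lerD2r.
  by have := fF x xB; rewrite ler_norml => /andP[].
by rewrite ler_norml; lra.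
Qed.

(** The difference [u' - u] solves an equation for [K'] with right-hand side
    [(f' - f) + (K' u - K u) - (m' - m)], to which both principles apply. The bound involves [u]
    alone, not [u']. *)
Lemma poisson_perturb K K' B f f' m m' u u' a :
  stochastic K' -> closed_set K' B -> B != finset.set0 ->
  poisson K B f m u -> poisson K' B f' m' u' ->
  (forall x, x \in B -> `|f' x - f x| + `|kmean K' u x - kmean K u x| <= a) ->
  `|m' - m| <= a.
Proof.
move=> Kst Kcl Bn0 fu fu' ffa.
have diff x : x \in B -> (u' x - u x) - kmean K' (fun y => u' y - u y) x =
    (f' x - f x) + (kmean K' u x - kmean K u x) - (m' - m).
  by move=> xB; rewrite kmeanB; have := fu x xB; have := fu' x xB; lra.
have bnd x : x \in B -> `|(f' x - f x) + (kmean K' u x - kmean K u x)| <= a.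
  by move=> xB; apply: le_trans (ler_normD _ _) (ffa x xB).
have h1 : - a - (m' - m) <= 0.
  apply: (min_principle (v := fun y => u' y - u y) Kst Kcl Bn0) => x xB.
  by rewrite diff // lerD2r; have := bnd x xB; rewrite ler_norml => /andP[].
have h2 : 0 <= a - (m' - m).
  apply: (max_principle (v := fun y => u' y - u y) Kst Kcl Bn0) => x xB.
  by rewrite diff // lerD2r; have := bnd x xB; rewrite ler_norml => /andP[].
by rewrite ler_norml; lra.
Qed.

(** * Bounds on the solution, uniform over the kernels dominating [c * H] *)

Lemma nstep_ge0 H n x y : stochastic H -> 0 <= nstep H n x y.
Proof.
move=> Hst; elim: n y => [|n IHn] y /=; first by rewrite ler0n.
by apply: sumr_ge0 => z _; rewrite mulr_ge0 // (Hst z).1.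
Qed.

Lemma sum_nstep H n x : stochastic H -> \sum_y nstep H n x y = 1.
Proof.
move=> Hst; elim: n => [|n IHn] /=.
  by rewrite (bigD1 x) //= eqxx big1 ?addr0 // => y /negPf->.
rewrite exchange_big -[RHS]IHn; apply: eq_bigr => z _ /=.
by rewrite -mulr_sumr (Hst z).2 mulr1.
Qed.

Lemma nstep_closed H B n x y : stochastic H -> closed_set H B -> x \in B ->
  nstep H n x y != 0 -> y \in B.
Proof.
move=> Hst Hcl xB; elim: n y => [|n IHn] y /=.
  by have [-> //|] := eqVneq y x; rewrite eqxx.
apply: contraNT => yNB; apply/eqP; apply: big1 => z _.
have [->|/IHn zB] := eqVneq (nstep H n x z) 0; first by rewrite mul0r.
by rewrite (contraNeq (Hcl z y zB) yNB) mulr0.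
Qed.

(* [K] follows each path of length [n] with at least [c ^+ n] times its
   probability under [H]. *)
Lemma nstep_growth K H B c d F n x : 0 <= c <= 1 -> 0 <= F -> stochastic K ->
  stochastic H -> closed_set H B ->
  (forall x y, x \in B -> c * H x y <= K x y) -> (forall y, 0 <= d y) ->
  (forall x, x \in B -> kmean K d x <= d x + F) -> x \in B ->
  c ^+ n * \sum_y nstep H n x y * d y <= d x + n%:R * F.
Proof.
move=> /andP[c0 c1] F0 Kst Hst Hcl HK d0 Kd xB; elim: n => [|n IHn] /=.
  rewrite expr0 mul1r mul0r addr0 (bigD1 x) //= eqxx mul1r big1 ?addr0 // => y.
  by move=> /negPf->; rewrite mul0r.
have -> : c ^+ n.+1 * \sum_y (\sum_z nstep H n x z * H z y) * d y =
    c ^+ n * \sum_z nstep H n x z * \sum_y c * H z y * d y.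
  rewrite exprSr -mulrA; congr (_ * _); rewrite mulr_sumr.
  under eq_bigr do rewrite mulr_suml mulr_sumr.
  rewrite exchange_big; apply: eq_bigr => z _; rewrite mulr_sumr.
  by apply: eq_bigr => y _; ring.
apply: (@le_trans _ _ (c ^+ n * \sum_z nstep H n x z * (d z + F))).
  rewrite ler_wpM2l ?exprn_ge0 //; apply: ler_sum => z _.
  have [->|/(nstep_closed Hst Hcl xB) zB] := eqVneq (nstep H n x z) 0.
    by rewrite !mul0r.
  rewrite ler_wpM2l ?nstep_ge0 //; apply: le_trans (Kd z zB).
  by apply: ler_sum => y _; rewrite ler_wpM2r ?HK.
under eq_bigr do rewrite mulrDr.
rewrite big_split -mulr_suml /= sum_nstep // mul1r mulrDr -natr1 mulrDl mul1r addrA.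
by rewrite lerD // ler_piMl // exprn_ile1.
Qed.

(** The deficit [d = max u - u] vanishes at a maximizer and grows in mean by at most [2 * F] per
    step of [K]. Since [K] reaches each [y] with a probability bounded below in terms of [H] and
    [c], the deficit at [y] is bounded. *)
Lemma poisson_osc H B c : 0 < c <= 1 -> stochastic H -> irreducible_on (fun x => x \in B) H ->
  exists2 C : R, 0 <= C & forall K f m u F,
    stochastic K -> closed_set K B -> (forall x y, x \in B -> c * H x y <= K x y) ->
    0 <= F -> (forall x, x \in B -> `|f x| <= F) -> poisson K B f m u ->
    forall x y, x \in B -> y \in B -> u x - u y <= C * F.
Proof.
move=> /andP[c0 c1] Hst Hirr.
have /choice[n nP] : forall xy : T * T, exists n : nat,
    xy.1 \in B -> xy.2 \in B -> 0 < nstep H n xy.1 xy.2.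
  move=> [x y] /=; case: (boolP (x \in B)) => xB; last by exists 0%N.
  case: (boolP (y \in B)) => yB; last by exists 0%N.
  by have [n ?] := Hirr x y xB yB; exists n.
(* The factor of [F] that [nstep_growth] yields for [n xy] steps with increment [2 * F]. The sum
   over all pairs dominates it wherever the maximizer lies. *)
pose b (xy : T * T) := (n xy)%:R * 2 / (c ^+ n xy * nstep H (n xy) xy.1 xy.2).
have b_ge0 xy : 0 <= b xy.
  by rewrite !mulr_ge0 ?invr_ge0 ?mulr_ge0 ?exprn_ge0 ?nstep_ge0 // ltW.
exists (\sum_xy b xy) => [|K f m u F Kst Kcl HK F0 fF fu x y xB yB].
  exact: sumr_ge0.
have Bn0 : B != finset.set0 by apply/finset.set0Pn; exists x.
have Hcl : closed_set H B.
  move=> z t zB Hzt; apply: (Kcl z t zB).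
  have pos : 0 < c * H z t by rewrite mulr_gt0 // lt_def Hzt (Hst z).1.
  by rewrite gt_eqF // (lt_le_trans pos (HK z t zB)).
have [x1 x1B x1max] : exists2 x1, x1 \in B & forall z, z \in B -> u z <= u x1.
  by case: (@arg_maxP _ _ _ x (mem B) u xB) => x1; exists x1.
(* Extended by 0 off [B], so that it is nonnegative everywhere. *)
pose d z := if z \in B then u x1 - u z else 0.
have d0 z : 0 <= d z by rewrite /d; case: ifP => // /x1max; rewrite subr_ge0.
have /ler_normlP[m1 m2] := poisson_mean_le Kst Kcl Bn0 fF fu.
have Kd z : z \in B -> kmean K d z <= d z + 2 * F.
  move=> zB; have -> : kmean K d z = u x1 - kmean K u z.
    rewrite -(kmean_cst (u x1) z Kst) -kmeanB; apply: eq_bigr => t _; rewrite /d.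
    by case: ifPn => // tB; rewrite (contraNeq (Kcl z t zB) tB) !mul0r.
  by rewrite /d zB; have /ler_normlP[] := fF z zB; have := fu z zB; lra.
have F2 : 0 <= 2 * F by rewrite mulr_ge0.
have c01 : 0 <= c <= 1 by rewrite ltW.
have := nstep_growth (n (x1, y)) c01 F2 Kst Hst Hcl HK d0 Kd x1B.
rewrite {2}/d x1B subrr add0r => growth.
apply: (@le_trans _ _ (d y)); first by rewrite /d yB lerD2r x1max.
apply: (@le_trans _ _ (b (x1, y) * F)); last first.
  by rewrite ler_wpM2r // (bigD1 (x1, y)) //= lerDl sumr_ge0.
have p0 := nP (x1, y) x1B yB; rewrite /= in p0.
rewrite /b /= mulrAC ler_pdivlMr ?mulr_gt0 ?exprn_gt0 // -mulrA.
apply: le_trans growth; rewrite mulrCA ler_wpM2l ?exprn_ge0 ?(ltW c0) //.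
rewrite mulrC [leRHS](bigD1 y) //= lerDl sumr_ge0 // => z _.
by rewrite mulr_ge0 ?nstep_ge0.
Qed.

(** A square linear system is solvable once its homogeneous version has only the zero solution. *)
Lemma poisson_exists K B x0 f : stochastic K -> closed_set K B -> x0 \in B ->
  (forall m u, poisson K B (fun=> 0) m u ->
    forall x y, x \in B -> y \in B -> u x - u y <= 0) ->
  exists m u, [/\ poisson K B f m u, u x0 = 0 & forall x, x \notin B -> u x = 0].
Proof.
move=> Kst Kcl x0B Kirr.
have Bn0 : B != finset.set0 by apply/finset.set0Pn; exists x0.
(* The normalisation [u x0 = 0] frees the coordinate [x0], which carries the unknown [m] instead.
   Off [B] the system is the identity. *)
pose a y x : R := if x \in B then
    if y == x0 then 1 else if y \in B then (x == y)%:R - K x y else 0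
  else (x == y)%:R.
pose A : 'M[R]_#|T| := \matrix_(j, i) a (enum_val j) (enum_val i).
pose V (v : 'rV[R]_#|T|) x : R := v 0 (enum_rank x).
pose ut (v : 'rV[R]_#|T|) x : R := if (x != x0) && (x \in B) then V v x else 0.
have mulA (v : 'rV_#|T|) x : (v *m A) 0 (enum_rank x) = \sum_y V v y * a y x.
  rewrite mxE (reindex_onto enum_rank enum_val) /=; last by move=> i _; rewrite enum_valK.
  by apply: eq_big => [y|y _]; rewrite ?enum_rankK ?eqxx // mxE !enum_rankK.
have mulAB (v : 'rV_#|T|) x : x \in B ->
    (v *m A) 0 (enum_rank x) = V v x0 + (ut v x - kmean K (ut v) x).
  move=> xB; rewrite mulA (bigD1 x0) //= {1}/a xB eqxx mulr1; congr (_ + _).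
  have -> : ut v x = \sum_y (x == y)%:R * ut v y.
    rewrite (bigD1 x) //= eqxx mul1r big1 ?addr0 // => y.
    by rewrite eq_sym => /negPf->; rewrite mul0r.
  rewrite /kmean -sumrB [RHS](bigD1 x0) //= {1 2}/ut eqxx /= !mulr0 subrr add0r.
  apply: eq_bigr => y yx0; rewrite /a xB (negPf yx0) /ut yx0 /=.
  by case: ifP; rewrite ?mulr0 ?subrr // => _; ring.
have mulANB (v : 'rV_#|T|) x : x \notin B -> (v *m A) 0 (enum_rank x) = V v x.
  move=> xNB; rewrite mulA (bigD1 x) //= /a (negPf xNB) eqxx mulr1 big1 ?addr0 // => y.
  by rewrite eq_sym => /negPf->; rewrite mulr0.
have Au : A \in unitmx.
  (* A vector annihilated by [A] solves the equation for the zero function: its mean is 0, and its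
     [u] is constant on [B] and zero at [x0]. *)
  rewrite -row_free_unit; apply: inj_row_free => v vA0.
  have v0 x : x \in B -> V v x0 + (ut v x - kmean K (ut v) x) = 0.
    by move=> xB; rewrite -mulAB // vA0 mxE.
  have vp : poisson K B (fun=> 0) (V v x0) (ut v).
    by move=> x xB; have := v0 x xB; lra.
  have V0 : V v x0 = 0.
    apply/eqP; rewrite -normr_le0.
    by apply: (poisson_mean_le Kst Kcl Bn0 _ vp) => x _; rewrite normr0.
  apply/rowP => i; rewrite mxE -(enum_valK i); move: (enum_val i) => x.
  rewrite -/(V v x); have [xB|xNB] := boolP (x \in B); last first.
    by rewrite -mulANB // vA0 mxE.
  have [->//|xx0] := eqVneq x x0.
  have utx0 : ut v x0 = 0 by rewrite /ut eqxx.
  have := Kirr _ _ vp x x0 xB x0B; have := Kirr _ _ vp x0 x x0B xB.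
  by rewrite utx0 /ut xx0 xB /=; lra.
pose v := \row_i (if enum_val i \in B then f (enum_val i) else 0) *m invmx A.
exists (V v x0), (ut v); split=> [x xB||x xNB]; last 2 first.
- by rewrite /ut eqxx.
- by rewrite /ut (negPf xNB) andbF.
have := mulAB v x xB; rewrite /v -mulmxA mulVmx // mulmx1 mxE enum_rankK xB => ->.
by rewrite addrC addKr.
Qed.

Lemma poisson_solution H B c : 0 < c <= 1 -> stochastic H -> B != finset.set0 ->
  irreducible_on (fun x => x \in B) H ->
  exists2 C : R, 0 <= C & forall K,
    stochastic K -> closed_set K B -> (forall x y, x \in B -> c * H x y <= K x y) ->
    forall f F, 0 <= F -> (forall x, x \in B -> `|f x| <= F) ->
    exists m u, poisson K B f m u /\ forall x, `|u x| <= C * F.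
Proof.
move=> c01 Hst /finset.set0Pn[x0 x0B] Hirr; have [C C0 osc] := poisson_osc c01 Hst Hirr.
exists C => // K Kst Kcl HK f F F0 fF.
have [|m [u [fu ux0 uNB]]] := poisson_exists f Kst Kcl x0B.
  (* With [F = 0] the oscillation bound makes homogeneous solutions constant on [B]. *)
  move=> m u mu x y xB yB; rewrite -(mulr0 C).
  by apply: (osc K (fun=> 0) m u 0) => // z _; rewrite normr0.
exists m, u; split=> // x; have [xB|/uNB->] := boolP (x \in B); last first.
  by rewrite normr0 mulr_ge0.
have := osc K f m u F Kst Kcl HK F0 fF fu; rewrite ler_norml => uF.
by have := uF x x0 xB x0B; have := uF x0 x x0B xB; rewrite ux0; lra.
Qed.

(** The set [B] of possible windows depends on the simple strategies and on the initial tangle, but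
    [T] has finitely many subsets, so the constants for all of them can be added. *)
Lemma poisson_solution_uniform H c :
  0 < c <= 1 -> stochastic H ->
  exists2 C : R, 0 <= C & forall B, B != finset.set0 ->
    irreducible_on (fun x => x \in B) H ->
    forall K, stochastic K -> closed_set K B -> (forall x y, x \in B -> c * H x y <= K x y) ->
    forall f F, 0 <= F -> (forall x, x \in B -> `|f x| <= F) ->
    exists m u, poisson K B f m u /\ forall x, `|u x| <= C * F.
Proof.
move=> c01 Hst.
pose P (B : {set T}) (C : R) := 0 <= C /\ (B != finset.set0 ->
    irreducible_on (fun x => x \in B) H ->
    forall K, stochastic K -> closed_set K B -> (forall x y, x \in B -> c * H x y <= K x y) ->
    forall f F, 0 <= F -> (forall x, x \in B -> `|f x| <= F) ->
    exists m u, poisson K B f m u /\ forall x, `|u x| <= C * F).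
have /choice[C CP] : forall B, exists C, P B C.
  move=> B; have [[Bn0 Birr]|nB] :=
    pselect (B != finset.set0 /\ irreducible_on (fun x => x \in B) H).
    by have [C C0 CP] := poisson_solution c01 Hst Bn0 Birr; exists C.
  by exists 0; split=> // Bn0 Birr; case: nB.
exists (\sum_B C B) => [|B Bn0 Birr K Kst Kcl HK f F F0 fF].
  by apply: sumr_ge0 => B _; exact: (CP B).1.
have [m [u [fu uC]]] := (CP B).2 Bn0 Birr K Kst Kcl HK f F F0 fF.
exists m, u; split=> // x; apply: le_trans (uC x) _; rewrite ler_wpM2r //.
by rewrite (bigD1 B) //= lerDl sumr_ge0 // => B' _; exact: (CP B').1.
Qed.

End Poisson.

(** * Additive functionals of a finite chain *)

Section Streams.
Context {St E : Type}.
Implicit Types (e : nat -> E).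

Definition shift k e : nat -> E := fun i => e (k + i)%N.

Definition scons a e : nat -> E := fun i => if i is j.+1 then e j else a.

Fixpoint state (step : St -> E -> St) g e n :=
  if n is n'.+1 then state step (step g (e 0%N)) (shift 1 e) n' else g.

Definition depends_on (A : Type) n (F : (nat -> E) -> A) :=
  forall e e', (forall i, (i < n)%N -> e i = e' i) -> F e = F e'.

Lemma stateS step g e n : state step g e n.+1 = step (state step g e n) (e n).
Proof. by elim: n g e => [//|n IHn] g e; rewrite /= -IHn. Qed.

Lemma eq_state step g e e' n : (forall i, (i < n)%N -> e i = e' i) ->
  state step g e n = state step g e' n.
Proof.
elim: n => [//|n IHn] ee; rewrite !stateS IHn => [|i lt_in]; last by rewrite ee // ltnW.
by rewrite ee.
Qed.

Lemma depends_on_scons (A : Type) n (F : (nat -> E) -> A) a :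
  depends_on n.+1 F -> depends_on n (fun e => F (scons a e)).
Proof. by move=> Fn e e' ee; apply: Fn => -[|i] //= /ee. Qed.

End Streams.

Section Chain.
Context {R : realType} {St E : finType} (step : St -> E -> St) (a0 : E).
Implicit Types (Q : St -> E -> R) (g : St) (B : {set St}) (e : nat -> E) (F G : (nat -> E) -> R).

Local Notation state := (state step).

(* The mean of [F] over the first [n] terms, the others being set to [a0]. *)
Fixpoint expect Q n g F : R :=
  if n is n'.+1 then \sum_a Q g a * expect Q n' (step g a) (fun e => F (scons a e))
  else F (fun=> a0).

Definition stochastic_choice Q := forall g, (forall a, 0 <= Q g a) /\ \sum_a Q g a = 1.

Definition closed_choice Q B := forall g a, g \in B -> Q g a != 0 -> step g a \in B.

Lemma eq_expect Q n g F G : F =1 G -> expect Q n g F = expect Q n g G.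
Proof. by move=> /funext->. Qed.

Lemma expectD Q n g F G :
  expect Q n g (fun e => F e + G e) = expect Q n g F + expect Q n g G.
Proof.
elim: n g F G => [//|n IHn] g F G /=; rewrite -big_split; apply: eq_bigr => a _ /=.
by rewrite IHn mulrDr.
Qed.

Lemma expectZ Q n g c F : expect Q n g (fun e => c * F e) = c * expect Q n g F.
Proof.
elim: n g F => [//|n IHn] g F /=; rewrite mulr_sumr; apply: eq_bigr => a _.
by rewrite IHn mulrCA.
Qed.

(** The form in which the recursive mean meets the probabilities of cylinders. *)
Lemma expect_tuple Q n g F : expect Q n g F =
  \sum_(t : n.-tuple E) (\prod_(i < n) Q (state g (nth a0 t) i) (nth a0 t i)) * F (nth a0 t).
Proof.
elim: n g F => [|n IHn] g F /=.
  rewrite (big_pred1 [tuple]) => [|t]; last first.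
    by apply/esym/eqP/val_inj; case: t => -[].
  by rewrite big_ord0 mul1r; congr F; apply/funext => i; rewrite nth_nil.
rewrite (reindex (fun at_ : E * n.-tuple E => cons_tuple at_.1 at_.2)) /=; last first.
  exists (fun t => (thead t, behead_tuple t)) => [[a t] _|t _] /=.
    by congr pair; apply: val_inj.
  by rewrite [RHS]tuple_eta; apply: val_inj.
rewrite -(pair_bigA _ (fun a (t : n.-tuple E) =>
  (\prod_(i < n.+1) Q (state g (nth a0 (a :: t)) i) (nth a0 (a :: t) i)) *
  F (nth a0 (a :: t)))) /=.
apply: eq_bigr => a _; rewrite IHn mulr_sumr; apply: eq_bigr => t _.
rewrite big_ord_recl /= mulrA; congr (_ * F _).
by apply/funext => -[|i].
Qed.

Section Stochastic.
Variables (Q : St -> E -> R) (Qst : stochastic_choice Q).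

Lemma expect_cst n g c : expect Q n g (fun=> c) = c.
Proof.
elim: n g => [//|n IHn] g /=; under eq_bigr do rewrite IHn.
by rewrite -mulr_suml (Qst g).2 mul1r.
Qed.

Lemma le_expect n g F G : (forall e, F e <= G e) -> expect Q n g F <= expect Q n g G.
Proof.
elim: n g F G => [|n IHn] g F G FG /=; first exact: FG.
by apply: ler_sum => a _; rewrite ler_wpM2l ?(Qst g).1 // IHn.
Qed.

Lemma expect_norm_le n g F c : (forall e, `|F e| <= c) -> `|expect Q n g F| <= c.
Proof.
move=> Fc; rewrite ler_norml -{1}(expect_cst n g (- c)) -{2}(expect_cst n g c).
by apply/andP; split; apply: le_expect => e; have := Fc e; rewrite ler_norml => /andP[].
Qed.

Lemma expect_depends m n g F : depends_on m F -> expect Q (m + n) g F = expect Q m g F.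
Proof.
elim: m g F => [|m IHm] g F Fm /=.
  rewrite -[RHS](expect_cst n g); apply: eq_expect => e; exact: Fm.
by apply: eq_bigr => a _; rewrite IHm //; exact: depends_on_scons.
Qed.

(** Markov property: given the first [m] terms, which determine [F], the factor [Z] starts afresh
    from the current state and has mean 0. *)
Lemma expect_tail0 B m n g F (Z : St -> (nat -> E) -> R) : closed_choice Q B ->
  depends_on m F -> (forall x, x \in B -> expect Q n x (Z x) = 0) -> g \in B ->
  expect Q (m + n) g (fun e => F e * Z (state g e m) (shift m e)) = 0.
Proof.
move=> Qcl + Z0; elim: m g F => [|m IHm] g F Fm gB.
  rewrite -(mulr0 (F (fun=> a0))) -(Z0 g gB) -expectZ add0n; apply: eq_expect => e /=.
  by rewrite (Fm e (fun=> a0)).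
rewrite addSn /=; apply: big1 => a _.
have [->|/(Qcl g a gB) gaB] := eqVneq (Q g a) 0; first by rewrite mul0r.
by rewrite (IHm (step g a) (fun e => F (scons a e))) ?mulr0 //; exact: depends_on_scons.
Qed.

End Stochastic.

(** Each of the [n] choices, when replaced, moves the mean by at most [d * c]. *)
Lemma expect_perturb Q Q' n g F c d : stochastic_choice Q -> stochastic_choice Q' ->
  (forall x, \sum_a `|Q' x a - Q x a| <= d) -> (forall e, `|F e| <= c) ->
  `|expect Q' n g F - expect Q n g F| <= n%:R * (d * c).
Proof.
move=> Qst Qst' QQ'; elim: n g F => [|n IHn] g F Fc /=.
  by rewrite subrr normr0 mul0r.
have c0 : 0 <= c := le_trans (normr_ge0 _) (Fc (fun=> a0)).
pose E1 a := expect Q n (step g a) (fun e => F (scons a e)).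
pose E2 a := expect Q' n (step g a) (fun e => F (scons a e)).
have -> : \sum_a Q' g a * E2 a - \sum_a Q g a * E1 a =
    \sum_a (Q' g a * (E2 a - E1 a) + (Q' g a - Q g a) * E1 a).
  by rewrite -sumrB; apply: eq_bigr => a _; ring.
apply: le_trans (ler_norm_sum _ _ _) _.
apply: (@le_trans _ _ (\sum_a (Q' g a * (n%:R * (d * c)) + `|Q' g a - Q g a| * c))).
  apply: ler_sum => a _; apply: le_trans (ler_normD _ _) _; rewrite !normrM lerD //.
    by rewrite (ger0_norm ((Qst' g).1 a)) ler_wpM2l ?(Qst' g).1 // IHn.
  by rewrite ler_wpM2l //; apply: expect_norm_le.
rewrite big_split -!mulr_suml (Qst' g).2 mul1r /= -natr1 mulrDl mul1r lerD2l.
by rewrite ler_wpM2r.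
Qed.

(** * Second moments of sums with finite-range dependence *)

Section SecondMoment.
Variables (Q : St -> E -> R) (Qst : stochastic_choice Q).
Variables (B : {set St}) (Qcl : closed_choice Q B).
Variables (M : nat) (C : R) (X : St -> (nat -> E) -> R).
Hypothesis X_depends : forall g, depends_on M.+1 (X g).
Hypothesis X_le : forall g e, `|X g e| <= C.
Hypothesis X_mean0 : forall g, g \in B -> expect Q M.+1 g (X g) = 0.

Definition additive n g e := \sum_(i < n) X (state g e i) (shift i e).

Lemma additiveS n g e :
  additive n.+1 g e = X g e + additive n (step g (e 0%N)) (shift 1 e).
Proof. by rewrite /additive big_ord_recl. Qed.

Lemma additiveD m n g e :
  additive (m + n) g e = additive m g e + additive n (state g e m) (shift m e).
Proof.
elim: m g e => [|m IHm] g e; first by rewrite /additive big_ord0 add0r.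
by rewrite addSn !additiveS IHm addrA.
Qed.

Lemma additive_norm_le n g e : `|additive n g e| <= n%:R * C.
Proof.
apply: le_trans (ler_norm_sum _ _ _) _.
rewrite -[n in n%:R]card_ord -sumr_const mulr_suml.
by apply: ler_sum => i _; rewrite mul1r X_le.
Qed.

(** The horizon is [n + M] because the last summand looks [M] terms beyond its index. *)
Lemma expect_additive n g : g \in B -> expect Q (n + M) g (additive n g) = 0.
Proof.
elim: n g => [|n IHn] g gB.
  rewrite -[RHS](expect_cst Qst M g); apply: eq_expect => e; exact: big_ord0.
rewrite (eq_expect _ _ _ (additiveS n g)) expectD addSnnS addnC expect_depends //.
rewrite X_mean0 // add0r addSn addnC /=; apply: big1 => a _.
have [->|/(Qcl gB) gaB] := eqVneq (Q g a) 0; first by rewrite mul0r.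
by rewrite (IHn _ gaB) mulr0.
Qed.

(** Only the next [M] summands share terms with [X g e]. The later ones start after the [M.+1] terms
    it depends on, and [expect_tail0] removes them. *)
Lemma expect_cross n g : g \in B ->
  expect Q (n.+1 + M) g (fun e => X g e * additive n (step g (e 0%N)) (shift 1 e)) <=
    M%:R * C ^+ 2.
Proof.
move=> gB.
have small k e x : (k <= M)%N -> X g e * additive k x (shift 1 e) <= M%:R * C ^+ 2.
  move=> kM; apply: le_trans (ler_norm _) _; rewrite normrM expr2 mulrCA.
  have C0 := le_trans (normr_ge0 _) (X_le g e).
  apply: ler_pM => //; apply: le_trans (additive_norm_le _ _ _) _.
  by rewrite ler_wpM2r // ler_nat.
have [nM|/ltnW Mn] := leqP n M.
  by rewrite -[leRHS](expect_cst Qst (n.+1 + M) g); apply: le_expect => // e; exact: small.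
rewrite -(subnKC Mn); move: (n - M)%N => k.
under eq_expect do rewrite additiveD mulrDr.
rewrite expectD -[leRHS]addr0 lerD //.
  rewrite -[leRHS](expect_cst Qst ((M + k).+1 + M) g).
  by apply: le_expect => // e; exact: small.
rewrite -addSn -addnA.
by rewrite (expect_tail0 (B := B) (m := M.+1) (Z := additive k)) // => x; exact: expect_additive.
Qed.

(** Expanding the square, each new summand adds at most [C ^+ 2] and twice a cross term of at most
    [M%:R * C ^+ 2]. *)
Lemma second_moment n g : g \in B ->
  expect Q (n + M) g (fun e => additive n g e ^+ 2) <= n%:R * ((M.*2.+1)%:R * C ^+ 2).
Proof.
elim: n g => [|n IHn] g gB.
  rewrite mul0r -[leRHS](expect_cst Qst M g); apply: le_expect => // e.
  by rewrite /additive big_ord0 expr2 mul0r.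
under eq_expect do rewrite additiveS sqrrD addrAC -mulr_natl.
rewrite !expectD expectZ.
have -> : n.+1%:R * ((M.*2.+1)%:R * C ^+ 2) =
    C ^+ 2 + n%:R * ((M.*2.+1)%:R * C ^+ 2) + 2 * (M%:R * C ^+ 2).
  by rewrite -!natr1 -mul2n natrM; ring.
rewrite lerD ?ler_wpM2l ?expect_cross // lerD //.
  rewrite -[leRHS](expect_cst Qst (n.+1 + M) g); apply: le_expect => // e.
  have C0 := le_trans (normr_ge0 _) (X_le g e).
  by rewrite -real_normK ?num_real // lerXn2r ?nnegrE.
set b := n%:R * _; rewrite -[leRHS]mul1r -(Qst g).2 mulr_suml addSn /=.
apply: ler_sum => a _.
have [->|/(Qcl gB) gaB] := eqVneq (Q g a) 0; first by rewrite !mul0r.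
by apply: ler_wpM2l; [exact: (Qst g).1|exact: (IHn (step g a) gaB)].
Qed.

(** Chebyshev's inequality. *)
Lemma additive_tail n g (a : R) : g \in B -> 0 < a ->
  expect Q (n + M) g (fun e => (a <= `|additive n g e|)%R%:R) <=
    n%:R * ((M.*2.+1)%:R * C ^+ 2) / a ^+ 2.
Proof.
move=> gB a0'; rewrite ler_pdivlMr ?exprn_gt0 // mulrC -expectZ.
apply: le_trans (second_moment n gB); apply: le_expect => // e.
have [ae|_] := boolP (a <= _); last by rewrite mulr0 sqr_ge0.
by rewrite mulr1 -[leRHS]real_normK ?num_real // lerXn2r ?nnegrE // ltW.
Qed.

End SecondMoment.
End Chain.

(** * Averages along subsequences *)

Section Averages.
Context {R : realType}.
Implicit Types (x W : nat -> R) (p : pred nat) (v : nat -> nat).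

Definition average x n : R := (\sum_(i < n) x i) / n%:R.

(* Between consecutive fourth powers the partial sums move by O(m ^ 3). *)
Lemma average_cvg0 x C : (forall i, `|x i| <= C) ->
  (exists m0, forall m, (m0 <= m)%N -> `|\sum_(i < m ^ 4) x i| <= (m ^ 3)%:R) ->
  (average x @ \oo --> (0 : R))%classic.
Proof.
move=> xC [m0 m0P]; have C0 := le_trans (normr_ge0 _) (xC 0%N).
apply/cvgrPdist_lt => /= eps eps0.
(* Below, the partial sum up to [n] is at most [(1 + 15 * C) * m ^ 3] with [m ^ 4 <= n], so [m] at
   least [K] suffices. *)
pose K := (maxn (maxn m0 1) (Num.truncn ((1 + 15 * C) / eps)).+1)%N.
have Keps : 1 + 15 * C < eps * K%:R.
  have := truncnS_gt ((1 + 15 * C) / eps); rewrite ltr_pdivrMr // => lt_eps.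
  by apply: lt_le_trans lt_eps _; rewrite mulrC ler_pM2l // ler_nat /K leq_maxr.
exists (K ^ 4)%N => // n /= Kn; rewrite sub0r normrN /average.
have ex_m : exists m, (m ^ 4 <= n)%N by exists 0%N.
have m_le m : (m ^ 4 <= n)%N -> (m <= n)%N.
  by apply: leq_trans; rewrite -{1}(expn1 m); case: m => // m; rewrite leq_pexp2l.
case: (ex_maxnP ex_m m_le) => m mn max_m.
have Km : (K <= m)%N by exact: max_m.
have m1 : (0 < m)%N by apply: leq_trans Km; rewrite /K !leq_max ltnS leq0n orbT.
have n_lt : (n < m.+1 ^ 4)%N by rewrite ltnNge; apply/negP => /max_m; rewrite ltnn.
(* For [m >= 1], the increment [4 m ^ 3 + 6 m ^ 2 + 4 m + 1] of the fourth power is at most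
   [15 m ^ 3]. *)
have gap : (n - m ^ 4 <= 15 * m ^ 3)%N by nia.
have n0 : (0 < n)%N by apply: leq_trans mn; rewrite expn_gt0 m1.
rewrite normrM normfV normr_nat ltr_pdivrMr ?ltr0n //.
have tail : `|\sum_(i < n) x i - \sum_(i < m ^ 4) x i| <= (15 * m ^ 3)%:R * C.
  rewrite -(big_mkord predT x) -(big_mkord predT x) (big_cat_nat _ mn) //= addrAC subrr add0r.
  apply: le_trans (ler_norm_sum _ _ _) _.
  apply: (@le_trans _ _ (\sum_(m ^ 4 <= i < n) C)); first exact: ler_sum.
  by rewrite sumr_const_nat -[leLHS]mulr_natl ler_wpM2r // ler_nat.
have head : `|\sum_(i < m ^ 4) x i| <= (m ^ 3)%:R.
  by apply: m0P; apply: leq_trans Km; rewrite /K !leq_max leqnn.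
have total : `|\sum_(i < n) x i| <= (1 + 15 * C) * (m ^ 3)%:R.
  move: head tail; move: (\sum_(i < n) _) (\sum_(i < m ^ 4) _) => a b hb hab.
  have := ler_normD b (a - b); rewrite addrC subrK; move: hab; rewrite natrM; lra.
apply: le_lt_trans total _.
have m3 : 0 < (m ^ 3)%:R :> R by rewrite ltr0n expn_gt0 m1.
apply: (@lt_le_trans _ _ (eps * K%:R * (m ^ 3)%:R)); first by rewrite ltr_pM2r.
rewrite -mulrA ler_wpM2l ?(ltW eps0) // -natrM ler_nat; apply: leq_trans mn.
by rewrite (expnS m 3) leq_mul2r Km orbT.
Qed.

Definition enumerates p v :=
  {homo v : i j / (i < j)%N} /\ forall i, p i <-> exists j, v j = i.

Lemma enumerates_geq p v n : enumerates p v -> (n <= v n)%N.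
Proof. by case=> vlt _; elim: n => // n IHn; apply: leq_ltn_trans IHn (vlt _ _ _). Qed.

Lemma sum_enumerates p v W n : enumerates p v ->
  \sum_(i < v n | p i) W i = \sum_(j < n) W (v j).
Proof.
move=> pv; have [vlt pP] := pv; have vle := ltnW_homo vlt.
elim: n => [|n IHn].
  rewrite big_ord0 big1 // => i /pP[j ji]; have := ltn_ord i.
  by rewrite -ji ltnNge vle.
rewrite big_ord_recr -IHn /= -!(big_mkord p W).
have vS := vlt _ _ (ltnSn n).
rewrite (big_cat_nat (leq0n (v n)) (ltnW vS)) /=.
congr (_ + _); rewrite big_ltn_cond //.
have -> : p (v n) by apply/pP; exists n.
rewrite big_nat_cond big1 ?addr0 // => i /andP[/andP[ni iS] /pP[j ji]].
move: ni iS; rewrite -ji => ni iS.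
have nj : (n < j)%N by rewrite ltnNge; apply/negP => /vle; rewrite leqNgt ni.
by have := vle _ _ nj; rewrite leqNgt iS.
Qed.

Lemma enumerates_exists p : (forall m, exists i, (m <= i)%N && p i) ->
  exists v, enumerates p v.
Proof.
move=> pinf; pose next m := ex_minn (pinf m).
pose v := fix v n := if n is n'.+1 then next (v n').+1 else next 0%N.
have vlt : {homo v : i j / (i < j)%N}.
  apply: homo_ltn => [|n /=]; first exact: ltn_trans.
  by rewrite /next; case: ex_minnP => i /andP[].
exists v; split=> // i; split=> [pi|[[|j] <-]]; last 2 first.
- by rewrite /= /next; case: ex_minnP => k /andP[].
- by rewrite /= /next; case: ex_minnP => k /andP[].
(* If [v] skipped [i], minimality of [next] would keep every [v j] below [i], although
   [v n >= n]. *)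
apply: contrapT => noj.
have v_lt j : (v j < i)%N.
  rewrite ltn_neqAle; apply/andP; split; first by apply/eqP => vj; apply: noj; exists j.
  elim: j => [|j IHj] /=; rewrite /next; case: ex_minnP => k _ kmin; apply: kmin => //.
  by rewrite pi andbT ltn_neqAle IHj andbT; apply/eqP => vj; apply: noj; exists j.
have v_ge n : (n <= v n)%N by elim: n => // n IHn; apply: leq_ltn_trans IHn (vlt _ _ _).
by have := v_lt i; rewrite ltnNge v_ge.
Qed.

(** If [p] failed from [m] on, its count would be at most [m] and its frequency would tend to 0. *)
Lemma count_lim_infinite p rho : 0 < rho ->
  (average (fun i => (p i)%:R) @ \oo --> (rho : R))%classic ->
  forall m, exists i, (m <= i)%N && p i.
Proof.
move=> rho0 cvg_p m; apply: contrapT => nop.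
have p0 i : (m <= i)%N -> p i = false.
  by move=> mi; apply/negP => pi; apply: nop; exists i; rewrite mi pi.
have cnt n : \sum_(i < n) (p i)%:R <= m%:R :> R.
  rewrite -natr_sum ler_nat -(big_mkord predT (fun i => p i : nat)).
  have [nm|/ltnW mn] := leqP n m.
    apply: leq_trans nm; rewrite big_mkord -[leqRHS]card_ord -sum1_card.
    by rewrite leq_sum // => i _; case: (p i).
  rewrite (big_cat_nat _ mn) //= [X in (_ + X)%N]big_nat_cond [X in (_ + X)%N]big1 ?addn0 => [|i].
    by rewrite big_mkord -[leqRHS]card_ord -sum1_card leq_sum // => i _; case: (p i).
  by rewrite andbT => /andP[mi _]; rewrite p0.
have lim0 : (average (fun i => (p i)%:R) @ \oo --> (0 : R))%classic.
  apply: (@squeeze_cvgr _ _ _ _ (fun=> 0) (fun n => m%:R * n%:R^-1)).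
  - apply: nearW => n; rewrite /average mulr_ge0 ?invr_ge0 ?sumr_ge0 //=.
    by rewrite ler_wpM2r ?invr_ge0 ?cnt.
  - exact: cvg_cst.
  - rewrite -(mulr0 m%:R); apply: cvgM; first exact: cvg_cst.
    by rewrite -cvg_shiftS; exact: cvg_harmonic.
have e : rho = 0 by rewrite -(cvg_lim _ cvg_p) // (cvg_lim _ lim0).
by move: rho0; rewrite e ltxx.
Qed.

(** At time [v n] exactly [n] indices satisfying [p] have passed, so the average along [v] is the
    quotient of the two time averages at that time. *)
Lemma average_enumerates p v W c rho : enumerates p v -> rho != 0 ->
  (average (fun i => (p i)%:R) @ \oo --> (rho : R))%classic ->
  (average (fun i => (p i)%:R * W i) @ \oo --> (c : R))%classic ->
  ((fun n => (\sum_(j < n) W (v j)) / n%:R) @ \oo --> (c / rho))%classic.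
Proof.
move=> pv rho0 cvg_p cvg_W.
have cvg_v : (v @ \oo --> \oo)%classic.
  move=> A [n _ nA]; exists n => // i /= ni; apply: nA => /=.
  exact: leq_trans ni (enumerates_geq i pv).
have -> : (fun n => (\sum_(j < n) W (v j)) / n%:R) =
    (fun n => average (fun i => (p i)%:R * W i) (v n) / average (fun i => (p i)%:R) (v n)).
  apply/funext => n; rewrite /average.
  have -> : \sum_(i < v n) (p i)%:R * W i = \sum_(j < n) W (v j).
    rewrite -(sum_enumerates W n pv) [RHS]big_mkcond; apply: eq_bigr => i _.
    by case: ifP; rewrite ?mul1r ?mul0r.
  have -> : \sum_(i < v n) (p i)%:R = n%:R :> R.
    rewrite -[in RHS](card_ord n) -sum1_card natr_sum -(sum_enumerates (fun=> 1) n pv).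
    by rewrite [RHS]big_mkcond; apply: eq_bigr => i _; case: ifP.
  have [->|n0] := posnP n; first by rewrite big_ord0 !mul0r.
  have vn0 : (v n)%:R != 0 :> R.
    by rewrite pnatr_eq0 -lt0n (leq_trans n0) // (enumerates_geq n pv).
  by rewrite invf_div mulrA mulfVK.
apply: cvgM; first exact: (cvg_comp _ _ cvg_v cvg_W).
by apply: cvgV => //; exact: (cvg_comp _ _ cvg_v cvg_p).
Qed.

End Averages.

(** * Shift invariance of the tangle *)

Lemma referencesE (T : eqType) (e : rel T) u v : references e u v <->
  e u v \/ exists2 y, e u y & references e y v.
Proof.
split=> [[[|y s] /= /andP[uy yv]]|[uv|[y uy [s yv]]]].
- by left.
- by right; exists y => //; exists s.
- by exists [::]; rewrite /= uv.
- by exists (y :: s); rewrite /= uy.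
Qed.

Section Windows.
Local Open Scope nat_scope.
Context {n1 M0 N L : nat} {init : nat -> nat * nat}.
Implicit Types (e : nat -> event N n1 M0) (i j x : nat).

Local Notation tangle := (tangle L init).
Local Notation badness := (badness L init).

Lemma window_before0 e : window_before L init e 0 = window n1 init L.
Proof.
apply/val_inj/ffunP => uv; rewrite /= !ffunE /window_arcs /tangle addn0.
by rewrite ltn_add2l ltn_ord.
Qed.

Lemma window_beforeS e i :
  window_before L init e i.+1 = next_window (window_before L init e i) (sites e i).
Proof.
apply/val_inj/ffunP => -[u v]; rewrite /= !ffunE /=; congr inord.
(* The newest row describes the arriving transaction [L + n1 + i]; every other row is an old row
   shifted by one. *)
rewrite /next_arcs; have [uS|uS] := eqVneq u.+1 n1.
  rewrite /window_arcs /Defs.tangle.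
  have -> : (L + i.+1 + u)%N = (L + n1 + i)%N by lia.
  have -> : (L + n1 + i < L + n1)%N = false by rewrite ltnNge leq_addr.
  have sE (s : nat) : (L + i + s == L + i.+1 + v)%N = (s == v.+1).
    by rewrite -!addnA eqn_add2l addSnnS eqn_add2l.
  rewrite addKn /= !sE.
  case: ltnP => // uv.
  have nosite (s : 'I_n1) : (nat_of_ord s == v.+1) = false.
    by apply/eqP => sv; have := ltn_ord s; lia.
  by rewrite !nosite.
have uS_lt : (u.+1 < n1)%N by rewrite ltn_neqAle uS ltn_ord.
rewrite /arcs insubT /=; case: insubP => [v' _ v'E|]; last first.
  rewrite -leqNgt => vS; rewrite /window_arcs ifN // -leqNgt.
  by have := ltn_ord v; lia.
rewrite ffunE /= v'E inordK.
  by rewrite /window_arcs !ltnS !addnS !addSn.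
by rewrite /window_arcs; case: ifP => // _; do 2!case: (_ == _).
Qed.

Hypothesis init_valid : valid_init L n1 init.

Lemma tangle_lt e u v : attaches (tangle e) u v -> (v < u)%N.
Proof.
move=> /andP[u0]; rewrite /Defs.tangle; case: ltnP => uL.
  have /andP[i1 i2] : ((init u).1 < u)%N && ((init u).2 < u)%N.
    by apply: init_valid; rewrite u0.
  by case/orP => /eqP<-.
have site_lt (s : 'I_n1) : (L + (u - (L + n1)) + s < u)%N by have := ltn_ord s; lia.
by case/orP => /eqP<-; exact: site_lt.
Qed.

Lemma tangle_references_lt e u v : references (attaches (tangle e)) u v -> (v < u)%N.
Proof.
case=> s; elim: s u => [|y s IHs] u /= /andP[]; first by move/tangle_lt.
by move=> /tangle_lt yu /IHs vy; apply: ltn_trans yu.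
Qed.

(** A path down to [L + i + n1] passes only through later transactions at offset at most [n1 + M0].
    Their attachments, relative to [L + i], are given by the events [i + 1] to [i + M0]. The
    induction is on the offset [x]. *)
Lemma references_transfer e e' i i' x :
  (forall j, (0 < j <= M0)%N -> e (i + j)%N = e' (i' + j)%N) -> (x <= n1 + M0)%N ->
  references (attaches (tangle e)) (L + i + x) (L + i + n1) ->
  references (attaches (tangle e')) (L + i' + x) (L + i' + n1).
Proof.
move=> ee; have [k] := ubnP x; elim: k x => // k IHk x /ltnSE xk xM ref.
have := tangle_references_lt ref; rewrite ltn_add2l => n1x.
have tE (f : nat -> event N n1 M0) (l : nat) : attaches (tangle f) (L + l + x)%N =1
    [pred y | (y == L + l + (x - n1 + (sites f (l + (x - n1))).1))%N
           || (y == L + l + (x - n1 + (sites f (l + (x - n1))).2))%N].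
  move=> y; rewrite /attaches /Defs.tangle.
  have -> : (L + l + x < L + n1)%N = false by apply/negbTE; rewrite -leqNgt; lia.
  have -> : (0 < L + l + x)%N by rewrite addn_gt0 (leq_ltn_trans _ n1x) ?orbT.
  have -> : (L + l + x - (L + n1))%N = (l + (x - n1))%N by lia.
  by rewrite !addnA ![_ == y]eq_sym.
have eE : sites e (i + (x - n1)) = sites e' (i' + (x - n1)).
  by rewrite /sites ee //; lia.
have main (s : 'I_n1) y : (y = L + i + (x - n1 + s))%N ->
    y = (L + i + n1)%N \/ references (attaches (tangle e)) y (L + i + n1) ->
    attaches (tangle e') (L + i' + x) (L + i' + (x - n1 + s)) ->
    references (attaches (tangle e')) (L + i' + x) (L + i' + n1).
  move=> -> [/eqP|ref' att']; last first.
    apply/referencesE; right; exists (L + i' + (x - n1 + s)) => //.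
    by apply: IHk ref'; have := ltn_ord s; lia.
  by rewrite eqn_add2l => /eqP -> att'; apply/referencesE; left.
have step y : attaches (tangle e) (L + i + x) y ->
    y = (L + i + n1)%N \/ references (attaches (tangle e)) y (L + i + n1) ->
    references (attaches (tangle e')) (L + i' + x) (L + i' + n1).
  rewrite tE inE eE => /orP[] /eqP yE yn; apply: (main _ y yE yn);
    by rewrite tE inE eqxx ?orbT.
by have [att|[y att ref']] := (referencesE _ _ _).1 ref; apply: (step _ att); [left|right].
Qed.

(** The [k]-th stop has offset [k.+2 + stops] from [L + i], within the range of
    [references_transfer]. The event [i] itself has no influence. *)
Lemma badness_transfer e e' i i' :
  (forall j, (0 < j <= M0)%N -> e (i + j)%N = e' (i' + j)%N) -> badness e i = badness e' i'.
Proof.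
move=> ee; apply: eq_bigr => k _; congr nat_of_bool.
have kM := ltn_ord k.
have sE : stops e (i + k.+1) k = stops e' (i' + k.+1) k by rewrite /stops ee.
have ee' j : (0 < j <= M0)%N -> e' (i' + j)%N = e (i + j)%N by move=> /ee.
have xM : (k.+2 + stops e (i + k.+1) k <= n1 + M0)%N.
  by have := ltn_ord (stops e (i + k.+1) k); lia.
have uE (l : nat) (f : nat -> event N n1 M0) : (L + (l + k.+1).+1 + stops f (l + k.+1) k)%N =
    (L + l + (k.+2 + stops f (l + k.+1) k))%N by lia.
rewrite !uE -sE ![(L + n1 + _)%N]addnAC; apply: asbool_equiv_eq.
by split=> nref ref; apply: nref; apply: references_transfer ref.
Qed.

Lemma badness_shift e i : badness e i = badness (shift i e) 0.
Proof. exact: badness_transfer. Qed.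

Lemma badness_le e i : (badness e i <= M0)%N.
Proof.
by rewrite -[leqRHS]card_ord -sum1_card; apply: leq_sum => k _; case: asboolP.
Qed.

End Windows.

(** * Almost sure convergence *)

Lemma measure_bigsetU_le d (T : measurableType d) (R : realType) (P : probability T R)
    (I : Type) (s : seq I) (A : I -> set T) : (forall i, measurable (A i)) ->
  (P (\big[setU/set0]_(i <- s) A i) <= \sum_(i <- s) P (A i))%E.
Proof.
move=> mA; elim: s => [|i s IHs]; first by rewrite !big_nil measure0.
rewrite !big_cons; apply: le_trans (leeD2l _ IHs).
by apply: measureU2 => //; apply: bigsetU_measurable => j _.
Qed.

Lemma sum_inv_sqr_le (R : realType) n : \sum_(m < n) (m.+1%:R ^+ 2)^-1 <= 2 :> R.
Proof.
(* Strengthened so that the induction closes. *)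
suff le_n : \sum_(m < n) (m.+1%:R ^+ 2)^-1 <= 2 * (1 - n.+1%:R^-1) :> R.
  apply: le_trans le_n _; rewrite ler_piMr // gerBl invr_ge0 //.
elim: n => [|n IHn]; first by rewrite big_ord0 invr1 subrr mulr0.
rewrite big_ord_recr /=; apply: le_trans (lerD IHn (lexx _)) _.
rewrite -(natr1 n.+1) -(natr1 n).
have : 0 <= n%:R :> R by []; move: (n%:R : R) => x x0.
rewrite -subr_ge0.
have -> : 2 * (1 - (x + 1 + 1)^-1) - (2 * (1 - (x + 1)^-1) + ((x + 1) ^+ 2)^-1) =
    x / ((x + 1) ^+ 2 * (x + 1 + 1)).
  by field; apply/andP; split; lra.
by rewrite divr_ge0 ?mulr_ge0 ?sqr_ge0 //; lra.
Qed.

Lemma borel_cantelli_sqr d (T : measurableType d) (R : realType) (P : probability T R)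
    (A : (set T)^nat) (K : R) : (forall m, measurable (A m)) ->
  (forall m, (P (A m) <= (K / m.+1%:R ^+ 2)%:E)%E) ->
  {ae P, forall om, exists m0, forall m, (m0 <= m)%N -> ~ A m om}.
Proof.
move=> mA PA.
have K0 : 0 <= K.
  have := le_trans (measure_ge0 P (A 0%N)) (PA 0%N).
  by rewrite lee_fin expr1n divr1.
have mlim : measurable (lim_sup_set A).
  by apply: bigcapT_measurable => n; apply: bigcup_measurable => k _.
exists (lim_sup_set A); split => //.
  apply: lim_sup_set_cvg0 => //; apply: (@le_lt_trans _ _ (K * 2)%:E); last exact: ltry.
  apply: lime_le; first by apply: is_cvg_nneseries.
  apply: nearW => n; rewrite big_mkord.
  apply: (@le_trans _ _ (\sum_(m < n) (K / m.+1%:R ^+ 2)%:E)%E).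
    by apply: lee_sum => m _; exact: PA.
  by rewrite sumEFin lee_fin -mulr_sumr ler_wpM2l // sum_inv_sqr_le.
move=> om /= nA n _; apply: contrapT => noA; apply: nA; exists n => m nm Am.
by apply: noA; exists m.
Qed.

(** * The law of large numbers for the window chain *)

Section Process.
Context {R : realType} {kappa : R} {n0 n1 M0 : nat} {w : walk_rule R}.
Context {L : nat} {init : nat -> nat * nat} {N : nat}.

Definition tangle_step (g : dag n1) (a : event N n1 M0) : dag n1 := next_window g a.1.2.

(** This is [event_prob] as a function of the current window alone, which makes the windows a Markov
    chain driven by the events. *)
Definition tangle_choice (S : 'I_N -> method R n1) (g : dag n1) (a : event N n1 M0) : R :=
  issuer_prob kappa a.1.1 * method_of n0 w S a.1.1 g a.1.2 *
  \prod_(k < M0) exit_law w (next_window g a.1.2) (a.2 k).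

Context {S : 'I_N -> method R n1} (T : tangle_process kappa n0 M0 w L init S).
Variable a0 : event N n1 M0.

Local Notation g0 := (window n1 init L).
Local Notation P := (prob T).
Local Notation traj om := (fun i => @events _ _ _ _ _ _ _ _ _ _ T i om).
Local Notation Q := (tangle_choice S).

Lemma window_before_state (e : nat -> event N n1 M0) i :
  window_before L init e i = state tangle_step g0 e i.
Proof.
elim: i => [|i IHi]; first exact: window_before0.
by rewrite window_beforeS stateS IHi.
Qed.

Lemma cylinder_prob n (e : nat -> event N n1 M0) :
  P [set om | forall i, (i < n)%N -> events i om = e i]%classic =
  (\prod_(i < n) Q (state tangle_step g0 e i) (e i))%:E.
Proof.
have -> : \prod_(i < n) Q (state tangle_step g0 e i) (e i) =
    \prod_(i < n) event_prob kappa n0 w L init S e i.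
  apply: eq_bigr => i _.
  have after : window_after L init e i = next_window (window_before L init e i) (sites e i).
    exact: window_beforeS.
  by rewrite /event_prob after window_before_state.
exact: events_law.
Qed.

Lemma cylinder_measurable n (e : nat -> event N n1 M0) :
  measurable [set om : Defs.space T | forall i, (i < n)%N -> events i om = e i]%classic.
Proof.
have -> : [set om : Defs.space T | forall i, (i < n)%N -> events i om = e i]%classic =
    (\bigcap_(i in [set i | (i < n)%N]) [set om | events i om = e i])%classic by [].
by apply: bigcap_measurableType => i _; exact: events_measurable.
Qed.

Lemma trajectory_event n (b : (nat -> event N n1 M0) -> bool) : depends_on n b ->
  [set om : Defs.space T | b (traj om)]%classic =
  (\big[setU/set0]_(t <- [seq t : n.-tuple _ <- enum {: n.-tuple (event N n1 M0)} | b (nth a0 t)])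
     [set om | forall i, (i < n)%N -> events i om = nth a0 t i])%classic.
Proof.
move=> bn; rewrite -bigcup_seq; apply/seteqP; split=> [om /= bom|om [t /=]].
  have te i : (i < n)%N -> traj om i = nth a0 [tuple traj om j | j < n] i.
    by move=> lt_in; rewrite -[i in RHS]/(nat_of_ord (Ordinal lt_in)) -tnth_nth tnth_mktuple.
  exists [tuple traj om j | j < n] => //=.
  by rewrite mem_filter mem_enum andbT -(bn _ _ te).
by rewrite mem_filter => /andP[bt _] te; rewrite (bn _ _ te).
Qed.

Lemma trajectory_measurable n (b : (nat -> event N n1 M0) -> bool) : depends_on n b ->
  measurable [set om : Defs.space T | b (traj om)]%classic.
Proof.
by move=> bn; rewrite (trajectory_event bn); apply: bigsetU_measurable => t _;
  exact: cylinder_measurable.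
Qed.

(** Borel-Cantelli asks for upper bounds, so subadditivity over the finitely many cylinders
    suffices. *)
Lemma trajectory_prob_le n (b : (nat -> event N n1 M0) -> bool) : depends_on n b ->
  (P [set om | b (traj om)]%classic <=
   (expect tangle_step a0 Q n g0 (fun e => (b e)%:R))%:E)%E.
Proof.
move=> bn; rewrite (trajectory_event bn).
apply: le_trans (measure_bigsetU_le _ _ _) _ => [t|]; first exact: cylinder_measurable.
under eq_bigr do rewrite cylinder_prob.
rewrite sumEFin lee_fin big_filter big_enum_cond /= expect_tuple [leLHS]big_mkcond /=.
by apply: ler_sum => t _; case: ifP => bt; rewrite ?mulr1 ?mulr0.
Qed.

Section LawOfLargeNumbers.
Variables (B : {set dag n1}) (M : nat) (h : (nat -> event N n1 M0) -> R) (Ch c : R).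
Variable (u : dag n1 -> R).
Hypotheses (Qst : stochastic_choice Q) (Qcl : closed_choice tangle_step Q B) (g0B : g0 \in B).
Hypotheses (h_dep : depends_on M.+1 h) (h_le : forall e, `|h e| <= Ch).
Hypothesis h_poisson : forall g, g \in B ->
  expect tangle_step a0 Q M.+1 g h - c = u g - \sum_a Q g a * u (tangle_step g a).

Lemma average_trajectory_cvg :
  {ae P, forall om, (average (fun i => h (shift i (traj om))) @ \oo --> c)%classic}.
Proof.
pose U := \sum_g `|u g|.
have uU g : `|u g| <= U by rewrite /U (bigD1 g) //= lerDl sumr_ge0.
have U0 : 0 <= U by exact: sumr_ge0.
(* By Poisson's equation this correction of [h - c] has mean 0 from every window of [B], and in sums
   the terms in [u] telescope. *)
pose X g (e : nat -> event N n1 M0) := h e - c - u g + u (tangle_step g (e 0%N)).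
have X_dep g : depends_on M.+1 (X g).
  by move=> e e' ee; rewrite /X (h_dep ee) ee.
pose C := Ch + `|c| + U + U.
have X_le g e : `|X g e| <= C.
  rewrite /X /C; apply: le_trans (ler_normD _ _) _; rewrite lerD //.
  apply: le_trans (ler_normB _ _) _; rewrite lerD //.
  by apply: le_trans (ler_normB _ _) _; rewrite lerD.
have X_mean0 g : g \in B -> expect tangle_step a0 Q M.+1 g (X g) = 0.
  move=> gB; have -> : expect tangle_step a0 Q M.+1 g (X g) =
      expect tangle_step a0 Q M.+1 g h + expect tangle_step a0 Q M.+1 g (fun=> - c - u g) +
      expect tangle_step a0 Q M.+1 g (fun e => u (tangle_step g (e 0%N))).
    by rewrite -!expectD; apply: eq_expect => e; rewrite /X; ring.
  rewrite expect_cst // /= -/(expect tangle_step a0 Q M.+1 g h).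
  have -> : \sum_a Q g a * expect tangle_step a0 Q M (tangle_step g a)
      (fun=> u (tangle_step g a)) = \sum_a Q g a * u (tangle_step g a).
    by apply: eq_bigr => a _; rewrite expect_cst.
  by have := h_poisson gB; lra.
(* At time [m ^ 4] with threshold [m ^ 3], Chebyshev's bound is of order [m ^ 4 / m ^ 6], which is
   summable. *)
pose A m := [set om : Defs.space T |
  (m.+1 ^ 3)%:R <= `|additive tangle_step X (m.+1 ^ 4) g0 (traj om)|]%classic.
have A_dep m : depends_on (m.+1 ^ 4 + M) (fun e : nat -> event N n1 M0 =>
    (m.+1 ^ 3)%:R <= `|additive tangle_step X (m.+1 ^ 4) g0 e|).
  move=> e e' ee; congr (_ <= `|_|); apply: eq_bigr => i _.
  have im := ltn_ord i; rewrite (eq_state _ _ (e' := e')) => [|j ji]; last first.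
    by apply: ee; rewrite ltn_addr // (ltn_trans ji).
  apply: X_dep => j jM; rewrite /shift ee //.
  by rewrite ltnS in jM; rewrite -addSn leq_add.
have mA m : measurable (A m) by exact: trajectory_measurable (A_dep m).
have PA m : (P (A m) <= ((M.*2.+1)%:R * C ^+ 2 / m.+1%:R ^+ 2)%:E)%E.
  apply: le_trans (trajectory_prob_le (A_dep m)) _; rewrite lee_fin.
  have m3 : 0 < (m.+1 ^ 3)%:R :> R by rewrite ltr0n expn_gt0.
  apply: le_trans (additive_tail Qst Qcl X_dep X_le X_mean0 (m.+1 ^ 4) g0B m3) _.
  have m0 : (m.+1)%:R != 0 :> R by rewrite pnatr_eq0.
  rewrite !natrX le_eqVlt; apply/orP; left; apply/eqP.
  by field.
apply: filterS (borel_cantelli_sqr mA PA) => om [m0 m0P].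
have X_avg : (average (fun i => X (state tangle_step g0 (traj om) i) (shift i (traj om)))
    @ \oo --> (0 : R))%classic.
  apply: (@average_cvg0 _ _ C) => [i|]; first exact: X_le.
  exists m0.+1 => -[//|m] /ltnSE /m0P /negP; rewrite -ltNge => /ltW; exact.
have tele n : \sum_(i < n) X (state tangle_step g0 (traj om) i) (shift i (traj om)) =
    \sum_(i < n) h (shift i (traj om)) - n%:R * c - u g0 + u (state tangle_step g0 (traj om) n).
  elim: n => [|n IHn]; first by rewrite !big_ord0 /=; ring.
  rewrite !big_ord_recr IHn stateS /= /X -natr1 /shift addn0; ring.
have h_avg : (fun n => average (fun i => h (shift i (traj om))) n.+1) =
    (fun n => average (fun i => X (state tangle_step g0 (traj om) i) (shift i (traj om))) n.+1
      + c + (u g0 - u (state tangle_step g0 (traj om) n.+1)) * n.+1%:R^-1).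
  apply/funext => n; rewrite /average tele.
  have n0' : n.+1%:R != 0 :> R by rewrite pnatr_eq0.
  by field.
have cvg_bound (a : R) : ((fun n => a * n.+1%:R^-1) @ \oo --> (0 : R))%classic.
  by rewrite -(mulr0 a); apply: cvgM; [exact: cvg_cst|exact: cvg_harmonic].
rewrite -cvg_shiftS in X_avg; rewrite -cvg_shiftS h_avg.
suff lim_sum : ((fun n => average
      (fun i => X (state tangle_step g0 (traj om) i) (shift i (traj om))) n.+1
      + c + (u g0 - u (state tangle_step g0 (traj om) n.+1)) * n.+1%:R^-1)
    @ \oo --> (0 + c + 0 : R))%classic by rewrite addr0 add0r in lim_sum.
apply: cvgD; first by apply: cvgD => //; exact: cvg_cst.
apply: squeeze_cvgr (cvg_bound (- (U + U))) (cvg_bound (U + U)); apply: nearW => n /=.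
have : `|u g0 - u (state tangle_step g0 (traj om) n.+1)| <= U + U.
  by rewrite (le_trans (ler_normB _ _)) // lerD.
by rewrite ler_norml => /andP[l1 l2]; rewrite !ler_wpM2r ?invr_ge0.
Qed.

End LawOfLargeNumbers.
End Process.

(** * Mean costs *)

Lemma mean_norm_le (R : realType) (I : finType) (p F : I -> R) b :
  (forall i, 0 <= p i) -> \sum_i p i = 1 -> (forall i, `|F i| <= b) ->
  `|\sum_i p i * F i| <= b.
Proof.
move=> p0 p1 Fb; have -> : b = \sum_i p i * b by rewrite -mulr_suml p1 mul1r.
apply: le_trans (ler_norm_sum _ _ _) _; apply: ler_sum => i _.
by rewrite normrM ger0_norm // ler_wpM2l.
Qed.

Section Transitions.
Context {R : realType} {kappa : R} {n0 n1 M0 : nat} {w : walk_rule R}.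
Context {L : nat} {init : nat -> nat * nat} {N : nat}.
Hypotheses (kappa_gt0 : 0 < kappa) (n0_lt_n1 : (n0 < n1)%N) (N_gt0 : (0 < N)%N).
Hypothesis w_valid : valid_walk_rule n1 w.
Implicit Types (S : 'I_N -> method R n1) (g : dag n1).

Local Notation D := (default_method (n1 := n1) n0 w).
Local Notation g0 := (window n1 init L).
Local Notation Q := (@tangle_choice R kappa n0 n1 M0 w N).
Local Notation step := (@tangle_step n1 M0 N).
Local Notation methods S := (forall k, attachment_method (S k)).

Definition share : R := ((kappa + 1) * N%:R)^-1.

Lemma share_gt0 : 0 < share.
Proof. by rewrite invr_gt0 mulr_gt0 ?ltr0n // addr_gt0. Qed.

Lemma issuer_prob_ge0 (o : option 'I_N) : 0 <= issuer_prob kappa o.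
Proof. by case: o => [k|] /=; rewrite ?(ltW share_gt0) // ltW // divr_gt0 // addr_gt0. Qed.

Lemma sum_option (F : option 'I_N -> R) : \sum_o F o = F None + \sum_k F (Some k).
Proof.
rewrite (bigD1 None) //=; congr (_ + _).
rewrite (reindex_omap Some id) /=; last by case.
by apply: eq_bigl => k; rewrite eqxx.
Qed.

Lemma sum_issuer_prob : \sum_(o : option 'I_N) issuer_prob kappa o = 1.
Proof.
rewrite sum_option /= sumr_const card_ord -[_ *+ N]mulr_natr.
have kappa1 : kappa + 1 != 0 by rewrite lt0r_neq0 // addr_gt0.
have Nn0 : N%:R != 0 :> R by rewrite pnatr_eq0 -lt0n.
by field; rewrite kappa1 Nn0.
Qed.

Lemma method_of_attachment S o : methods S -> attachment_method (method_of n0 w S o).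
Proof. by case: o => [k|] Smet //=; exact: default_attachment. Qed.

Lemma sum_exits g : \sum_(z : {ffun 'I_M0 -> 'I_n1}) \prod_k exit_law w g (z k) = 1.
Proof.
have n1_gt0 : (0 < n1)%N by apply: leq_ltn_trans n0_lt_n1.
rewrite -(bigA_distr_bigA (fun _ i => exit_law w g i)) big1 // => k _.
exact: (sum_exit_law w_valid g n1_gt0 (leqnn n1)).
Qed.

Lemma sum_tangle_choice S g (F : option 'I_N -> 'I_n1 * 'I_n1 -> R) :
  \sum_a Q S g a * F a.1.1 a.1.2 =
  \sum_o issuer_prob kappa o * \sum_p method_of n0 w S o g p * F o p.
Proof.
rewrite -(pair_bigA _ (fun op z => Q S g (op, z) * F op.1 op.2)) /=.
rewrite -(pair_bigA _ (fun o p => \sum_z Q S g (o, p, z) * F o p)) /=.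
apply: eq_bigr => o _; rewrite mulr_sumr; apply: eq_bigr => p _.
by rewrite -mulr_suml /tangle_choice /= -mulr_sumr sum_exits mulr1 mulrA.
Qed.

Lemma tangle_choice_stochastic S : methods S -> stochastic_choice (Q S).
Proof.
move=> Smet g; have n1_gt0 : (0 < n1)%N by apply: leq_ltn_trans n0_lt_n1.
split=> [a|].
  rewrite !mulr_ge0 ?issuer_prob_ge0 //; first exact: (method_of_attachment _ Smet _).1.
  by apply: prodr_ge0 => k _; exact: (exit_law_ge0 w_valid _ n1_gt0 (leqnn n1)).
under eq_bigr do rewrite -[Q S g _]mulr1.
rewrite (sum_tangle_choice S g (fun _ _ => 1)) -[RHS]sum_issuer_prob.
apply: eq_bigr => o _; under eq_bigr do rewrite mulr1.
by rewrite (method_of_attachment _ Smet _).2 mulr1.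
Qed.

Lemma sum_tangle_choice_issuer S g k (F : 'I_n1 * 'I_n1 -> R) :
  \sum_a Q S g a * ((a.1.1 == Some k)%:R * F a.1.2) = share * \sum_p S k g p * F p.
Proof.
rewrite (sum_tangle_choice S g (fun o p => (o == Some k)%:R * F p)).
rewrite (bigD1 (Some k)) //= [X in _ + X]big1 ?addr0 => [|o /negPf ok].
  by under eq_bigr do rewrite eqxx mul1r.
by rewrite ok big1 ?mulr0 // => p _; rewrite mul0r mulr0.
Qed.

(** Events not issued by [k] keep their probability; those issued by [k] have total mass [share]
    under either profile. *)
Lemma tangle_choice_perturb S S' k g : methods S -> methods S' ->
  (forall i, i != k -> S' i = S i) -> \sum_a `|Q S' g a - Q S g a| <= 2 * share.
Proof.
move=> Smet Smet' SS.
have mass S1 : methods S1 -> \sum_a Q S1 g a * (a.1.1 == Some k)%:R = share.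
  move=> S1met; under eq_bigr do rewrite -[(_ == _)%:R]mulr1.
  rewrite (sum_tangle_choice_issuer S1 g k (fun=> 1)); under eq_bigr do rewrite mulr1.
  by rewrite (S1met k g).2 mulr1.
rewrite mulr_natl mulr2n -{1}(mass S' Smet') -(mass S Smet) -big_split.
apply: ler_sum => a _ /=; rewrite -mulrDl.
have [ak|ak] := eqVneq a.1.1 (Some k).
  rewrite mulr1; apply: le_trans (ler_normB _ _) _.
  by rewrite !ger0_norm ?(tangle_choice_stochastic _ _).1.
rewrite mulr0 /tangle_choice /method_of; case: a.1.1 ak => [i|] ik; last by rewrite subrr normr0.
by rewrite SS ?subrr ?normr0 //; apply: contraNneq ik => ->.
Qed.

Definition tangle_kernel S g g' : R := \sum_(a | step g a == g') Q S g a.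

Lemma kmean_tangle_kernel S u g :
  kmean (tangle_kernel S) u g = \sum_a Q S g a * u (step g a).
Proof.
rewrite (partition_big (step g) predT) //=; apply: eq_bigr => g' _.
by rewrite mulr_suml; apply: eq_bigr => a /eqP->.
Qed.

Lemma tangle_kernel_stochastic S : methods S -> stochastic (tangle_kernel S).
Proof.
move=> Smet g; have [Q0 Q1] := tangle_choice_stochastic Smet g.
split=> [g'|]; first exact: sumr_ge0.
have := kmean_tangle_kernel S (fun=> 1) g; rewrite /kmean.
by under eq_bigr do rewrite mulr1; under [RHS]eq_bigr do rewrite mulr1; rewrite Q1.
Qed.

Lemma default_kernel_stochastic : stochastic (window_kernel D).
Proof.
move=> g; have [D0 D1] := default_attachment w_valid n0_lt_n1 g.
split=> [g'|]; first by apply: sumr_ge0.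
rewrite -[RHS]D1 (partition_big (next_window g) predT) //=.
Qed.

Lemma tangle_kernel_ge S g g' : methods S ->
  kappa / (kappa + 1) * window_kernel D g g' <= tangle_kernel S g g'.
Proof.
move=> Smet; rewrite /tangle_kernel big_mkcond /=.
have -> : \sum_a (if step g a == g' then Q S g a else 0) =
    \sum_a Q S g a * (next_window g a.1.2 == g')%:R.
  by apply: eq_bigr => a _; rewrite /tangle_step; case: ifP; rewrite ?mulr1 ?mulr0.
rewrite (sum_tangle_choice S g (fun _ p => (next_window g p == g')%:R)) sum_option /=.
have -> : window_kernel D g g' = \sum_p D g p * (next_window g p == g')%:R.
  by rewrite /window_kernel big_mkcond; apply: eq_bigr => p _; case: ifP; rewrite ?mulr1 ?mulr0.
rewrite lerDl; apply: sumr_ge0 => k _; rewrite mulr_ge0 ?(ltW share_gt0) //.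
by apply: sumr_ge0 => p _; rewrite mulr_ge0 // (Smet k g).1.
Qed.

Lemma tangle_kernel_closed S B : closed_choice step (Q S) B -> closed_set (tangle_kernel S) B.
Proof.
move=> Qcl g g' gB; apply: contraNT => g'B; apply/eqP; apply: big1 => a /eqP ag'.
by apply/eqP; apply: contraNT g'B => Qa; rewrite -ag'; exact: Qcl.
Qed.

Variable a0 : event N n1 M0.

Local Notation badness := (badness L init).

(** The mean of W for a transaction whose attachment has just produced the window [g]. Its own
    event, on which W does not depend, is filled in by [a0]. *)
Definition future_cost S g : R :=
  expect step a0 (Q S) M0 g (fun e => (badness (scons a0 e) 0)%:R).

Definition issued_cost k (e : nat -> event N n1 M0) : R :=
  (issuer e 0 == Some k)%:R * (badness e 0)%:R.

Hypothesis init_valid : valid_init L n1 init.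

Lemma issued_cost_depends k : depends_on M0.+1 (issued_cost k).
Proof.
move=> e e' ee; rewrite /issued_cost /issuer ee //; congr (_ * _%:R).
by apply: (badness_transfer init_valid) => j /andP[_ jM]; rewrite !add0n ee.
Qed.

Lemma issued_cost_le k e : `|issued_cost k e| <= M0%:R.
Proof.
rewrite ger0_norm ?mulr_ge0 //; apply: le_trans (_ : (badness e 0)%:R <= _).
  by rewrite ler_piMl // lern1 leq_b1.
by rewrite ler_nat badness_le.
Qed.

Lemma future_cost_le S g : methods S -> `|future_cost S g| <= M0%:R.
Proof.
move=> Smet; apply: expect_norm_le => [|e]; first exact: tangle_choice_stochastic.
by rewrite normr_nat ler_nat badness_le.
Qed.

Lemma expect_issued_cost S g k :
  expect step a0 (Q S) M0.+1 g (issued_cost k) =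
  share * \sum_p S k g p * future_cost S (next_window g p).
Proof.
rewrite -(sum_tangle_choice_issuer S g k (fun p => future_cost S (next_window g p))) /=.
apply: eq_bigr => a _; congr (_ * _).
rewrite -expectZ; apply: eq_expect => e; congr (_ * _%:R).
by apply: (badness_transfer init_valid) => -[].
Qed.

Lemma expect_issued_cost_le S g k : methods S ->
  `|expect step a0 (Q S) M0.+1 g (issued_cost k)| <= share * M0%:R.
Proof.
move=> Smet; rewrite expect_issued_cost normrM (ger0_norm (ltW share_gt0)).
rewrite ler_wpM2l ?(ltW share_gt0) //.
by apply: mean_norm_le (Smet k g).1 (Smet k g).2 _ => p; exact: future_cost_le.
Qed.

(** Node [j] issues with the same probability and method as before, so only the law of the next [M0]
    events changes, each by at most [2 * share]. *)
Lemma expect_issued_cost_perturb S S' k j g : methods S -> methods S' ->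
  (forall i, i != k -> S' i = S i) -> j != k ->
  `|expect step a0 (Q S') M0.+1 g (issued_cost j) -
    expect step a0 (Q S) M0.+1 g (issued_cost j)| <=
  share * (M0%:R * (2 * share * M0%:R)).
Proof.
move=> Smet Smet' SS jk; rewrite !expect_issued_cost -mulrBr normrM.
rewrite (ger0_norm (ltW share_gt0)) ler_wpM2l ?(ltW share_gt0) // SS // -sumrB.
under eq_bigr do rewrite -mulrBr.
apply: mean_norm_le (Smet j g).1 (Smet j g).2 _ => p.
apply: expect_perturb => [||x|e]; try exact: tangle_choice_stochastic.
  exact: tangle_choice_perturb SS.
by rewrite normr_nat ler_nat badness_le.
Qed.

(** The law of large numbers is applied to the cost issued by [k] and to the number of its
    transactions; the mean cost is the quotient of the limits. *)
Lemma mean_cost_poisson S (T : tangle_process kappa n0 M0 w L init S) B k c u :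
  methods S -> closed_choice step (Q S) B -> g0 \in B ->
  poisson (tangle_kernel S) B (fun g => expect step a0 (Q S) M0.+1 g (issued_cost k)) c u ->
  mean_cost T k = M0%:R^-1 * (c / share).
Proof.
move=> Smet Qcl g0B fu; have Qst := tangle_choice_stochastic Smet.
pose issued (e : nat -> event N n1 M0) : R := (issuer e 0 == Some k)%:R.
have issued_dep : depends_on M0.+1 issued by move=> e e' ee; rewrite /issued /issuer ee.
have issued_le e : `|issued e| <= 1 by rewrite normr_nat lern1 leq_b1.
(* Node [k] issues with probability [share] from every window, so Poisson's equation holds with the
   zero function. *)
have issued_mean g : g \in B -> expect step a0 (Q S) M0.+1 g issued - share =
    (fun=> 0) g - \sum_a Q S g a * (fun=> 0) (step g a).
  move=> _; rewrite [in RHS]big1 => [|a _]; last by rewrite mulr0.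
  rewrite subr0 /=; apply/eqP; rewrite subr_eq0; apply/eqP.
  transitivity (\sum_a Q S g a * ((a.1.1 == Some k)%:R * 1)).
    by apply: eq_bigr => a _; rewrite mulr1 expect_cst.
  rewrite (sum_tangle_choice_issuer S g k (fun=> 1)); under eq_bigr do rewrite mulr1.
  by rewrite (Smet k g).2 mulr1.
have cost_mean g : g \in B -> expect step a0 (Q S) M0.+1 g (issued_cost k) - c =
    u g - \sum_a Q S g a * u (step g a).
  by move=> gB; rewrite -kmean_tangle_kernel fu.
have count_cvg := average_trajectory_cvg T Qst Qcl g0B issued_dep issued_le issued_mean.
have cost_cvg := average_trajectory_cvg T Qst Qcl g0B (@issued_cost_depends k)
  (issued_cost_le k) cost_mean.
pose traj om i := @events _ _ _ _ _ _ _ _ _ _ T i om.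
have lim_cost : {ae prob T, forall om,
    (exists v, enumerates (fun i => issuer (traj om) i == Some k) v) /\
    forall v, enumerates (fun i => issuer (traj om) i == Some k) v ->
      ((fun n => (\sum_(j < n) (badness (traj om) (v j))%:R) / n%:R : R) @ \oo -->
        (c / share))%classic}.
  apply: filterS2 count_cvg cost_cvg => om cvg1 cvg2.
  pose p i := issuer (traj om) i == Some k.
  have cvg_p : (average (fun i => (p i)%:R) @ \oo --> (share : R))%classic.
    have <- : (fun i => issued (shift i (traj om))) = (fun i => (p i)%:R).
      by apply/funext => i; rewrite /issued /p /issuer /shift addn0.
    exact: cvg1.
  have cvg_W : (average (fun i => (p i)%:R * (badness (traj om) i)%:R) @ \oo --> (c : R))%classic.
    have <- : (fun i => issued_cost k (shift i (traj om))) =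
        (fun i => (p i)%:R * (badness (traj om) i)%:R).
      apply/funext => i; rewrite (badness_shift init_valid (traj om) i).
      by rewrite /issued_cost /p /issuer /shift addn0.
    exact: cvg2.
  split=> [|v pv].
    by apply: enumerates_exists; exact: count_lim_infinite share_gt0 cvg_p.
  apply: average_enumerates pv _ cvg_p cvg_W; exact: lt0r_neq0 share_gt0.
have badE om l : mean_badness L init (traj om) k l <->
    exists2 v, enumerates (fun i => issuer (traj om) i == Some k) v &
      ((fun n => (\sum_(j < n) (badness (traj om) (v j))%:R) / n%:R : R) @ \oo --> l)%classic.
  have sumE (v : nat -> nat) : (fun n => (\sum_(j < n) badness (traj om) (v j))%:R / n%:R : R) =
      (fun n => (\sum_(j < n) (badness (traj om) (v j))%:R) / n%:R).
    by apply/funext => n; rewrite natr_sum.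
  split=> [[v [vlt vp vl]]|[v [vlt vp] vl]]; exists v.
  - by split=> // i; split=> [/eqP/vp|/vp/eqP].
  - by rewrite -sumE.
  - by split=> // [i|]; [split=> [/eqP/vp|/vp/eqP]|rewrite sumE].
rewrite /mean_cost; congr (_ * _); apply: xget_unique.
  apply: filterS lim_cost => om [[v pv] vl]; apply/badE; exists v => //; exact: vl.
(* Two almost sure statements hold together at some point, where the limit is unique. *)
move=> l l_ae; have ae_proper : ProperFilter (almost_everywhere (prob T)).
  have T_gt0 : (0 < prob T setT)%E by rewrite probability_setT.
  exact: ae_properfilter_algebraOfSetsType T_gt0.
have [om [l_om [_ lim_c]]] := @filter_ex _ _ ae_proper _ (filterI l_ae lim_cost).
have [v pv lim_l] := (badE om l).1 l_om.
by rewrite -(cvg_lim _ lim_l) // (cvg_lim _ (lim_c v pv)).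
Qed.

End Transitions.

(** * Comparison of two nodes in an equilibrium *)

Theorem theorem3p3 (R : realType) (kappa : R) (n0 n1 M0 : nat) (w : walk_rule R)
    (kappa_gt0 : 0 < kappa) (n0_gt0 : (0 < n0)%N) (n0_lt_n1 : (n0 < n1)%N)
    (M0_gt0 : (0 < M0)%N) (w_valid : valid_walk_rule n1 w)
    (eps : R) (eps_gt0 : 0 < eps) :
  exists N0 : nat,
  forall (A : Type) (J : A -> method R n1) (L : nat) (init : nat -> nat * nat),
  simple_strategies n0 J ->
  valid_init L n1 init ->
  let D := default_method n0 w in
  let G := possible D J (window n1 init L) in
  irreducible_on G (window_kernel D) ->
  aperiodic_on G (window_kernel D) ->
  forall N : nat, (N0 <= N)%N ->
  forall (T : forall S : 'I_N -> mixed_strategy J, Tangle kappa n0 M0 w L init S)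
         (S : 'I_N -> mixed_strategy J),
  nash_equilibrium T S ->
  forall k j : 'I_N, `|mean_cost (T S) k - mean_cost (T S) j| < eps.
Proof.
have c01 : 0 < kappa / (kappa + 1) <= 1.
  have k1 : 0 < kappa + 1 by rewrite addr_gt0.
  by rewrite divr_gt0 //= ler_pdivrMr // mul1r lerDl.
have [C C0 CP] := poisson_solution_uniform c01 (default_kernel_stochastic n0_lt_n1 w_valid).
(* The two terms bound, in units of [rho ^+ 2], the changes in the cost function and in the kernel
   applied to [u]. *)
pose C' : R := M0%:R * (2 * M0%:R) + 2 * (C * M0%:R).
have C'0 : 0 <= C' by rewrite addr_ge0 ?mulr_ge0.
exists (Num.truncn (M0%:R^-1 * C' / eps)).+1 => A J L init [Jsimple _] init_valid D G Girr _.
move=> N N0N T S nash.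
have N_gt0 : (0 < N)%N by apply: leq_ltn_trans N0N.
pose rho : R := @share R kappa N.
have rho0 : 0 < rho by exact: share_gt0.
have Jatt b : attachment_method (J b) := (Jsimple b).1.
have met (S1 : 'I_N -> mixed_strategy J) k : attachment_method (sval (S1 k)).
  by case: (S1 k) => S' S'mixed /=; exact: mixed_attachment S'mixed.
pose B := [set g | `[< G g >]]%SET.
have BP g : (g \in B) = `[< G g >] by rewrite finset.inE.
have g0B : window n1 init L \in B by rewrite BP; apply/asboolP; exact: possible0.
have Bn0 : B != finset.set0 by apply/finset.set0Pn; exists (window n1 init L).
have Birr : irreducible_on (fun g => g \in B) (window_kernel D).
  by move=> g g'; rewrite !BP => /asboolP gG /asboolP g'G; exact: Girr.
have Qcl (S1 : 'I_N -> mixed_strategy J) : closed_choice (@tangle_step n1 M0 N)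
    (@tangle_choice R kappa n0 n1 M0 w N (fun k => sval (S1 k))) B.
  move=> g [op z]; case: op => o p; rewrite !BP => /asboolP gG Qn0; apply/asboolP.
  have : 0 < method_of n0 w (fun k => sval (S1 k)) o g p.
    rewrite lt_def (method_of_attachment n0_lt_n1 w_valid o (met S1) g).1 andbT.
    by apply: contraNneq Qn0; rewrite /tangle_choice /= => ->; rewrite mulr0 mul0r.
  case: o {Qn0} => [k|] /=; last exact: possible_default.
  case: (S1 k) => S' S'mixed /= /(mixed_gt0 Jatt S'mixed)[b]; exact: possible_simple.
have a0 : event N n1 M0.
  have z : 'I_n1 by exists 0%N; apply: leq_ltn_trans n0_lt_n1.
  exact: (None, (z, z), [ffun=> z]).
pose f (S1 : 'I_N -> mixed_strategy J) k g :=
  expect (@tangle_step n1 M0 N) a0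
    (@tangle_choice R kappa n0 n1 M0 w N (fun k => sval (S1 k))) M0.+1 g
    (issued_cost (L := L) (init := init) k).
pose K (S1 : 'I_N -> mixed_strategy J) :=
  @tangle_kernel R kappa n0 n1 M0 w N (fun k => sval (S1 k)).
have Kst S1 : stochastic (K S1) by exact: tangle_kernel_stochastic.
have Kcl S1 : closed_set (K S1) B by exact: tangle_kernel_closed.
(* The cost function is itself of order [rho], hence so is [u]. A perturbation of order [rho] then
   moves [m] by order [rho ^+ 2], which remains of order [rho] after division by [rho]. *)
have solve S1 k : exists m u, poisson (K S1) B (f S1 k) m u /\
    forall g, `|u g| <= C * (rho * M0%:R).
  apply: (CP B Bn0 Birr) => //.
  - by move=> g g' _; exact: tangle_kernel_ge.
  - by rewrite mulr_ge0 // ltW.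
  - by move=> g _; exact: expect_issued_cost_le.
have costE S1 k m u : poisson (K S1) B (f S1 k) m u ->
    mean_cost (T S1) k = M0%:R^-1 * (m / rho).
  exact: (mean_cost_poisson kappa_gt0 n0_lt_n1 N_gt0 w_valid init_valid
    (T S1) (met S1) (Qcl S1) g0B).
pose gap := M0%:R^-1 * (rho * C').
have gap_ge0 : 0 <= gap.
  by rewrite /gap mulr_ge0 ?invr_ge0 // mulr_ge0 // ltW.
have gap_lt : gap < eps.
  have rhoN : rho <= N%:R^-1.
    rewrite lef_pV2 ?posrE ?ltr0n //; first by rewrite ler_peMl // lerDr ltW.
    by rewrite mulr_gt0 ?ltr0n // addr_gt0.
  have := truncnS_gt (M0%:R^-1 * C' / eps); rewrite ltr_pdivrMr // => lt_eps.
  apply: (@le_lt_trans _ _ (M0%:R^-1 * C' / N%:R)).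
    by rewrite /gap [rho * _]mulrC mulrA ler_wpM2l ?mulr_ge0 ?invr_ge0.
  rewrite ltr_pdivrMr ?ltr0n //; apply: lt_le_trans lt_eps _.
  by rewrite mulrC ler_pM2l // ler_nat.
have le_gap k j : mean_cost (T S) k <= mean_cost (T S) j + gap.
  have [->|jk] := eqVneq j k; first by rewrite lerDl.
  pose S' := deviate S k (S j).
  have S'k : S' k = S j by rewrite /S' /deviate eqxx.
  have SS' i : i != k -> S' i = S i by rewrite /S' /deviate => /negPf->.
  have SSval i : i != k -> sval (S' i) = sval (S i) by move=> ik; rewrite SS'.
  have [m [u [mu uC]]] := solve S j.
  have [m' [u' [mu' _]]] := solve S' j.
  apply: le_trans (nash k (S j)) _; rewrite -/S'.
  (* After the deviation both nodes use the same method, so their expected issued costs agree and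
     one solution serves both. *)
  have -> : mean_cost (T S') k = mean_cost (T S') j.
    rewrite (costE S' j m' u' mu'); apply: (costE S' k m' u').
    move=> g gB; rewrite -mu' //; congr (_ - _).
    rewrite /f !(expect_issued_cost n0_lt_n1 w_valid) //.
    by rewrite S'k SS'.
  rewrite (costE S' j m' u' mu') (costE S j m u mu) /gap -mulrDr ler_wpM2l ?invr_ge0 //.
  rewrite -lerBlDl -mulrBl ler_pdivrMr //.
  apply: le_trans (ler_norm _) _; apply: (poisson_perturb (Kst S') (Kcl S') Bn0 mu mu').
  move=> g gB; rewrite /C' mulrDr mulrDl; apply: lerD.
    apply: le_trans (_ : rho * (M0%:R * (2 * rho * M0%:R)) <= _).
      exact: (expect_issued_cost_perturb kappa_gt0 n0_lt_n1 N_gt0 w_valid a0 init_valid g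
        (met S) (met S') SSval jk).
    by rewrite le_eqVlt; apply/orP; left; apply/eqP; ring.
  rewrite /K !kmean_tangle_kernel -sumrB.
  apply: le_trans (ler_norm_sum _ _ _) _.
  apply: (@le_trans _ _ (2 * rho * (C * (rho * M0%:R)))); last first.
    by rewrite le_eqVlt; apply/orP; left; apply/eqP; ring.
  apply: (@le_trans _ _ (\sum_a `|@tangle_choice R kappa n0 n1 M0 w N (fun k => sval (S' k)) g a
      - @tangle_choice R kappa n0 n1 M0 w N (fun k => sval (S k)) g a| * (C * (rho * M0%:R)))).
    by apply: ler_sum => a _; rewrite -mulrBl normrM ler_wpM2l.
  rewrite -mulr_suml ler_wpM2r ?mulr_ge0 ?(ltW rho0) //.
  exact: (tangle_choice_perturb kappa_gt0 n0_lt_n1 N_gt0 w_valid g (met S) (met S') SSval).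
move=> k j; apply: le_lt_trans gap_lt; rewrite ler_norml.
by have := le_gap k j; have := le_gap j k; lra.
Qed.
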